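(* Let $R$ be a principal ideal domain, let $S$ be a specialisation-closed subset of $\operatorname{Spec}(R)$, and let $\mathcal{T}_S=\{X\in D^b(\operatorname{proj} R):\operatorname{Supp}(X)\subseteq S\}$. Then: (1) if $S=\operatorname{Spec}(R)$, then $K_0(\mathcal{T}_S)$ is an infinite cyclic group generated by (the class of) $R$; (2) if $S\ne\operatorname{Spec}(R)$, then $K_0(\mathcal{T}_S)$ is a free abelian group on (the classes of) the Moore complexes $M(p)$, for $p\in S$.
   Context: $D^b(\operatorname{proj} R)$ is the chain homotopy category of perfect complexes, i.e. bounded complexes of finitely generated projective $R$-modules; it is a triangulated category. $K_0(\mathcal{T})$ of an essentially small triangulated category is the free abelian group on isomorphism classes of objects modulo $[B]=[A]+[C]$ for each exact triangle $A\to B\to C\to\Sigma A$. $\operatorname{Supp}(X)=\{\mathfrak{p}\in\operatorname{Spec}(R):X\otimes R_{\mathfrak{p}}\ne0\}$ (non-zero in the derived category). A subset $S$ of $\operatorname{Spec}(R)$ is specialisation-closed if $\mathfrak{p}\in S$ and $\mathfrak{p}\subseteq\mathfrak{q}$ imply $\mathfrak{q}\in S$. For $x\in R$, the Moore complex $M(x)$ is the cofibre of $x:R\to R$ in the derived category. In (2), every element of $S$ is a maximal ideal $(p)$ generated by a prime element $p$, and one chooses one generator $p$ for each ideal in $S$. *)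

(* Defs.v *)
From HB Require Import structures.
From mathcomp Require Import all_boot all_order all_algebra.
From mathcomp Require Import all_classical.
From mathcomp Require Import ring zify.

Set Implicit Arguments.
Unset Strict Implicit.
Unset Printing Implicit Defensive.

Import GRing.Theory.

Local Open Scope classical_set_scope.
Local Open Scope quotient_scope.
Local Open Scope ring_scope.

(** * Ideals and the prime spectrum *)

Definition is_ideal (R : idomainType) (I : {pred R}) : Prop :=
  0 \in I /\ forall a, {in I &, forall u v, a * u + v \in I}.

Definition generates (R : idomainType) (a : R) (I : {pred R}) : Prop :=
  forall x, x \in I <-> exists b, x = b * a.

Definition principal_ideal_domain (R : idomainType) : Prop :=
  forall I : {pred R}, is_ideal I -> exists a, generates a I.

(* [idealr_closed] contains the condition that 1 is not a member. *)
Record spec (R : idomainType) := Spec {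
  prime_pred : R -> bool;
  prime_ideal : idealr_closed prime_pred;
  prime_prime : prime_idealr_closed prime_pred
}.

Coercion mem_prime (R : idomainType) (p : spec R) : {pred R} := prime_pred p.

Definition specialisation_closed (R : idomainType) (S : set (spec R)) : Prop :=
  forall p q : spec R, S p -> {subset p <= q} -> S q.

(** * Localisation of a module at a prime ideal *)

Section Localisation.
Variables (R : idomainType) (p : spec R).

Definition denom := {s : R | s \notin p}.
HB.instance Definition _ := Choice.on denom.

Lemma denom1_subproof : 1 \notin p.
Proof. by case: (prime_ideal p). Qed.

Lemma denomM_subproof (s t : denom) : sval s * sval t \notin p.
Proof.
apply/negP => /(@prime_prime R p _ _) /orP[] st; [have := valP s | have := valP t];
  by rewrite st.
Qed.

Definition denom1 : denom := exist _ 1 denom1_subproof.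
Definition denomM (s t : denom) : denom := exist _ (sval s * sval t) (denomM_subproof s t).

Variable M : lmodType R.
Implicit Types x y z : (M * denom)%type.

(* m / s = n / t  iff  u (t m - s n) = 0 for some u outside p. *)
Definition loc_rel x y : bool :=
  `[< exists u : denom, sval u *: (sval y.2 *: x.1 - sval x.2 *: y.1) = 0 >].

Lemma loc_rel_refl : reflexive loc_rel.
Proof. by move=> x; apply/asboolP; exists denom1; rewrite subrr scaler0. Qed.

Lemma loc_rel_sym : symmetric loc_rel.
Proof.
suff H x y : loc_rel x y -> loc_rel y x by move=> x y; apply/idP/idP; apply: H.
move=> /asboolP[u e]; apply/asboolP; exists u.
by rewrite -opprB scalerN e oppr0.
Qed.

Lemma loc_rel_trans : transitive loc_rel.
Proof.
move=> [n t] [m s] [k r] /asboolP[u /= e1] /asboolP[v /= e2].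
apply/asboolP; exists (denomM (denomM u v) t) => /=.
move: e1 e2; rewrite !scalerBr => /subr0_eq e1 /subr0_eq e2.
transitivity ((sval v * sval r) *: (sval u *: (sval t *: m))
    - (sval u * sval s) *: (sval v *: (sval t *: k))).
  rewrite !scalerA; congr (_ *: _ - _ *: _); ring.
rewrite e1 -e2 !scalerA; apply/eqP; rewrite subr_eq0; apply/eqP.
by congr (_ *: _); ring.
Qed.

Canonical loc_equiv := EquivRel loc_rel loc_rel_refl loc_rel_sym loc_rel_trans.

Definition loc := {eq_quot loc_rel}.
HB.instance Definition _ := Choice.on loc.
HB.instance Definition _ := EqQuotient.on loc.

Definition frac x : loc := \pi_loc x.

Lemma frac_eq x y :
  frac x = frac y <-> exists u : denom,
    sval u *: (sval y.2 *: x.1) = sval u *: (sval x.2 *: y.1).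
Proof.
split=> [/eqmodP/asboolP[u e] | [u e]].
  by exists u; apply/eqP; rewrite -subr_eq0 -scalerBr e.
by apply/eqmodP/asboolP; exists u; rewrite scalerBr e subrr.
Qed.

Definition loc_zero : loc := frac (0, denom1).
Definition loc_opp (a : loc) : loc := let x := repr a in frac (- x.1, x.2).
Definition loc_add (a b : loc) : loc :=
  let x := repr a in let y := repr b in
  frac (sval y.2 *: x.1 + sval x.2 *: y.1, denomM x.2 y.2).
Definition loc_scale (c : R) (a : loc) : loc :=
  let x := repr a in frac (c *: x.1, x.2).

Lemma loc_reprP x : exists u : denom,
  sval u *: (sval x.2 *: (repr (frac x)).1)
    = sval u *: (sval (repr (frac x)).2 *: x.1).
Proof. by apply/frac_eq; rewrite /frac reprK. Qed.

Lemma loc_opp_frac x : loc_opp (frac x) = frac (- x.1, x.2).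
Proof.
have [u e] := loc_reprP x.
by apply/frac_eq; exists u; rewrite /= !scalerN e.
Qed.

Lemma loc_scale_frac c x : loc_scale c (frac x) = frac (c *: x.1, x.2).
Proof.
have [u e] := loc_reprP x.
apply/frac_eq; exists u => /=.
have := congr1 (fun m => c *: m) e; rewrite !scalerA => e'.
by rewrite [_ * c]mulrC mulrA e'; congr (_ *: _); ring.
Qed.

Lemma loc_add_frac x y : loc_add (frac x) (frac y)
  = frac (sval y.2 *: x.1 + sval x.2 *: y.1, denomM x.2 y.2).
Proof.
have [u e] := loc_reprP x; have [v f] := loc_reprP y.
rewrite /loc_add; move: (repr _) e (repr _) f => [m s] /= e [n t] /= f.
apply/frac_eq; exists (denomM u v) => /=.
have := congr1 (fun m => (sval v * sval t * sval y.2) *: m) e.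
have := congr1 (fun m => (sval u * sval s * sval x.2) *: m) f.
rewrite !scalerDr !scalerA => f' e'; congr (_ + _).
  by apply: etrans (etrans e' _); congr (_ *: _); ring.
by apply: etrans (etrans f' _); congr (_ *: _); ring.
Qed.

Lemma loc_ind (P : loc -> Prop) : (forall m s, P (frac (m, s))) -> forall a, P a.
Proof. by move=> H a; rewrite -[a]reprK -/(frac _); case: (repr a). Qed.

Lemma loc_eq1 x y : sval y.2 *: x.1 = sval x.2 *: y.1 -> frac x = frac y.
Proof. by move=> e; apply/frac_eq; exists denom1; rewrite e. Qed.

Lemma loc_addA : associative loc_add.
Proof.
elim/loc_ind => m s; elim/loc_ind => n t; elim/loc_ind => k r.
rewrite !loc_add_frac; apply: loc_eq1 => /=; rewrite !scalerDr !scalerA addrA.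
by congr (_ *: _ + _ *: _ + _ *: _); ring.
Qed.

Lemma loc_addC : commutative loc_add.
Proof.
elim/loc_ind => m s; elim/loc_ind => n t.
rewrite !loc_add_frac; apply: loc_eq1 => /=; rewrite !scalerDr !scalerA addrC.
by congr (_ *: _ + _ *: _); ring.
Qed.

Lemma loc_add0 : left_id loc_zero loc_add.
Proof.
elim/loc_ind => m s; rewrite loc_add_frac; apply: loc_eq1 => /=.
by rewrite scaler0 add0r !scalerA; congr (_ *: _); ring.
Qed.

Lemma loc_addN : left_inverse loc_zero loc_opp loc_add.
Proof.
elim/loc_ind => m s; rewrite loc_opp_frac loc_add_frac; apply: loc_eq1 => /=.
by rewrite scalerN addNr !scaler0.
Qed.

HB.instance Definition _ := GRing.isZmodule.Build loc loc_addA loc_addC loc_add0 loc_addN.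

Lemma loc_addE (a b : loc) : a + b = loc_add a b. Proof. by []. Qed.

Lemma loc_scaleA a b (v : loc) : loc_scale a (loc_scale b v) = loc_scale (a * b) v.
Proof. by elim/loc_ind: v => m s; rewrite !loc_scale_frac /= scalerA. Qed.

Lemma loc_scale1 : left_id 1 loc_scale.
Proof. by elim/loc_ind => m s; rewrite loc_scale_frac /= scale1r. Qed.

Lemma loc_scaleDr : right_distributive loc_scale +%R.
Proof.
move=> c; elim/loc_ind => m s; elim/loc_ind => n t.
rewrite !loc_addE loc_add_frac 3!loc_scale_frac loc_add_frac; apply: loc_eq1 => /=.
by rewrite !scalerDr !scalerA; congr (_ *: _ + _ *: _); ring.
Qed.

Lemma loc_scaleDl (v : loc) : {morph loc_scale^~ v : a b / a + b}.
Proof.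
move=> a b; elim/loc_ind: v => m s.
rewrite loc_addE !loc_scale_frac !loc_add_frac; apply: loc_eq1 => /=.
by rewrite !scalerA -!scalerDl !scalerA; congr (_ *: _); ring.
Qed.

HB.instance Definition _ :=
  GRing.Zmodule_isLmodule.Build R loc loc_scaleA loc_scale1 loc_scaleDr loc_scaleDl.

Lemma loc_scaleE (c : R) (a : loc) : c *: a = loc_scale c a. Proof. by []. Qed.
End Localisation.

Section LocalisationMap.
Variables (R : idomainType) (p : spec R) (M N : lmodType R).
Variable f : {linear M -> N}.

Definition loc_map (a : loc p M) : loc p N :=
  let x := repr a in frac (f x.1, x.2).

Lemma loc_map_frac x : loc_map (frac x) = frac (f x.1, x.2).
Proof.
have [u e] := loc_reprP x; apply/frac_eq; exists u => /=.
by have := congr1 f e; rewrite !(linearZZ f).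
Qed.

Lemma loc_map_linear : linear loc_map.
Proof.
move=> c; elim/loc_ind => m s; elim/loc_ind => n t.
rewrite !loc_scaleE !loc_addE loc_scale_frac loc_add_frac 3!loc_map_frac.
rewrite loc_scale_frac loc_add_frac; apply: loc_eq1.
by rewrite /= !linearD /= !linearZ.
Qed.
HB.instance Definition _ := GRing.isLinear.Build R (loc p M) (loc p N) _
  loc_map loc_map_linear.
End LocalisationMap.
Arguments loc_map {R} p {M N} f.



(** * Finitely generated projective modules *)

Definition finitely_generated (R : idomainType) (M : lmodType R) : Prop :=
  exists (n : nat) (g : 'I_n -> M),
    forall x, exists c : 'I_n -> R, x = \sum_i c i *: g i.

Definition projective (R : idomainType) (M : lmodType R) : Prop :=
  forall (A B : lmodType R) (g : {linear A -> B}) (f : {linear M -> B}),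
    (forall b, exists a, g a = b) ->
    exists h : {linear M -> A}, forall x, g (h x) = f x.

Record proj_module (R : idomainType) := ProjModule {
  proj_lmod :> lmodType R;
  proj_fg : finitely_generated proj_lmod;
  proj_proj : projective proj_lmod
}.

Definition mk_linear (R : idomainType) (M N : lmodType R) (f : M -> N)
    (lin : linear f) : {linear M -> N} :=
  HB.pack_for {linear M -> N} f (GRing.isLinear.Build R M N _ f lin).

Section ProjModules.
Variable R : idomainType.

Lemma zero_fg : finitely_generated 'rV[R]_0.
Proof.
by exists 0%N, (fun=> 0) => x; exists (fun=> 0); rewrite big_ord0; apply/rowP => -[].
Qed.

Lemma zero_proj : projective 'rV[R]_0.
Proof.
move=> A B g f _; exists \0 => x.
by rewrite (_ : x = 0) ?linear0 //; apply/rowP => -[].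
Qed.

Definition zero_module : proj_module R := ProjModule zero_fg zero_proj.

Lemma regular_fg : finitely_generated (R^o : lmodType R).
Proof.
exists 1%N, (fun=> 1) => x; exists (fun=> x).
by rewrite big_ord_recl big_ord0 addr0 /GRing.scale /= mulr1.
Qed.

Lemma regular_proj : projective (R^o : lmodType R).
Proof.
move=> A B g f surj; have [a ga] := surj (f 1).
have lin : linear (fun x : R^o => (x : R) *: a).
  by move=> c x y; rewrite scalerDl scalerA.
pose h := mk_linear lin.
exists h => x; rewrite /= linearZ ga /= -(linearZZ f).
by congr (f _); rewrite /GRing.scale /= mulr1.
Qed.

Definition regular_module : proj_module R := ProjModule regular_fg regular_proj.

Variables M N : lmodType R.

Lemma pair_linE (c : R) (x x' : M) (y y' : N) :
  c *: (x, y) + (x', y') = (c *: x + x', c *: y + y').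
Proof. by []. Qed.

Lemma prod_fg : finitely_generated M -> finitely_generated N ->
  finitely_generated (M * N)%type.
Proof.
move=> [m [g gP]] [n [h hP]].
exists (m + n)%N, (fun i : 'I_(m + n) => match fintype.split i with inl j => (g j, 0) | inr j => (0, h j) end).
move=> [x y]; have [c ->] := gP x; have [d ->] := hP y.
exists (fun i : 'I_(m + n) => match fintype.split i with inl j => c j | inr j => d j end).
rewrite big_split_ord /=.
under [X in _ = X + _]eq_bigr => i _ do rewrite (unsplitK (inl i)).
under [X in _ = _ + X]eq_bigr => i _ do rewrite (unsplitK (inr i)).
apply/pair_equal_spec; split; rewrite /= raddf_sum raddf_sum /=.
  by rewrite [X in _ + X]big1 ?addr0 // => i _; rewrite scaler0.
by rewrite [X in X + _]big1 ?add0r // => i _; rewrite scaler0.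
Qed.

Lemma prod_proj : projective M -> projective N -> projective (M * N)%type.
Proof.
move=> pM pN A B g f surj.
have linl : linear (fun x : M => f (x, 0)).
  by move=> c x y; rewrite -linearP pair_linE scaler0 addr0.
have linr : linear (fun y : N => f (0, y)).
  by move=> c x y; rewrite -linearP pair_linE scaler0 addr0.
pose fl := mk_linear linl.
pose fr := mk_linear linr.
have [h hP] := pM A B g fl surj; have [k kP] := pN A B g fr surj.
have lin : linear (fun v : M * N => h v.1 + k v.2).
  by move=> c x y; rewrite /= !linearP scalerDr addrACA.
pose hk := mk_linear lin.
exists hk => -[x y]; rewrite /= linearD hP kP /= -linearD; congr (f _).
by apply/pair_equal_spec; rewrite /= addr0 add0r.
Qed.
End ProjModules.

Definition prod_module (R : idomainType) (P Q : proj_module R) : proj_module R :=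
  @ProjModule R (P * Q)%type
    (prod_fg (@proj_fg R P) (@proj_fg R Q)) (prod_proj (@proj_proj R P) (@proj_proj R Q)).

(** * Perfect complexes *)

(* Cohomological grading: [term n] is the module in homological degree - n.
   With differentials of degree + 1, suspensions and cones involve no transport
   between [term (n - 1 + 1)] and [term n]. *)

Definition succz (n : int) : int := n + 1.
Arguments succz n : simpl never.

Record perfect (R : idomainType) := Perfect {
  term :> int -> proj_module R;
  diff : forall n, {linear term n -> term (succz n)};
  diff_diff : forall n (x : term n), diff (succz n) (diff n x) = 0;
  bounded : exists N : nat, forall n : int, (N < `|n|)%N -> forall x : term n, x = 0
}.

Arguments diff {R} X n : rename.
Arguments diff_diff {R} X n x : rename.
Arguments bounded {R} X : rename.

Record chain_map (R : idomainType) (X Y : perfect R) := ChainMap {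
  chain_fun :> forall n, {linear X n -> Y n};
  chain_comm : forall n (x : X n), chain_fun (succz n) (diff X n x) = diff Y n (chain_fun n x)
}.

(* The homotopy equation in degree n + 1, where n ranges over all integers. *)
Definition homotopic (R : idomainType) (X Y : perfect R) (f g : chain_map X Y) : Prop :=
  exists h : forall n, {linear X (succz n) -> Y n},
    forall n (x : X (succz n)),
      f (succz n) x - g (succz n) x = diff Y n (h n x) + h (succz n) (diff X (succz n) x).

Section Complexes.
Variable R : idomainType.
Implicit Types X Y Z A B C : perfect R.

Lemma chain_id_comm X n (x : X n) : idfun (diff X n x) = diff X n (idfun x).
Proof. by []. Qed.

Definition chain_id X : chain_map X X :=
  @ChainMap R X X (fun n => idfun) (@chain_id_comm X).

Lemma chain_comp_comm X Y Z (g : chain_map Y Z) (f : chain_map X Y) n (x : X n) :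
  (g (succz n) \o f (succz n)) (diff X n x) = diff Z n ((g n \o f n) x).
Proof. by rewrite /= !chain_comm. Qed.

Definition chain_comp X Y Z (g : chain_map Y Z) (f : chain_map X Y) : chain_map X Z :=
  @ChainMap R X Z (fun n => g n \o f n) (chain_comp_comm g f).

(* An isomorphism in the homotopy category. *)
Definition homotopy_equivalence X Y (f : chain_map X Y) : Prop :=
  exists g : chain_map Y X,
    homotopic (chain_comp g f) (chain_id X) /\ homotopic (chain_comp f g) (chain_id Y).

Definition isomorphic X Y : Prop := exists f : chain_map X Y, homotopy_equivalence f.

(** ** Suspension, mapping cone and exact triangles *)

Lemma suspension_diff_diff X n (x : X (succz n)) :
  (\- diff X (succz (succz n))) ((\- diff X (succz n)) x) = 0.
Proof. by rewrite /= linearN diff_diff !oppr0. Qed.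

Lemma suspension_bounded X :
  exists N : nat, forall n : int, (N < `|n|)%N -> forall x : X (succz n), x = 0.
Proof. by have [N bN] := bounded X; exists N.+1 => n nN x; apply: bN; rewrite /succz; lia. Qed.

Definition suspension X : perfect R :=
  @Perfect R (fun n => X (succz n)) (fun n => \- diff X (succz n))
    (@suspension_diff_diff X) (suspension_bounded X).

Lemma suspension_map_comm X Y (f : chain_map X Y) n (x : suspension X n) :
  f (succz (succz n)) (diff (suspension X) n x) = diff (suspension Y) n (f (succz n) x).
Proof. by rewrite /= linearN chain_comm. Qed.

Definition suspension_map X Y (f : chain_map X Y) :
    chain_map (suspension X) (suspension Y) :=
  @ChainMap R (suspension X) (suspension Y) (fun n => f (succz n)) (suspension_map_comm f).

Section Cone.
Variables (X Y : perfect R) (f : chain_map X Y).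

Definition cone_diff n (v : X (succz n) * Y n) : X (succz (succz n)) * Y (succz n) :=
  (- diff X (succz n) v.1, f (succz n) v.1 + diff Y n v.2).

Lemma cone_diff_linear n : linear (@cone_diff n).
Proof.
move=> c [x y] [x' y']; rewrite /cone_diff /= pair_linE; congr pair.
  by rewrite linearP opprD scalerN.
by rewrite !linearP scalerDr addrACA.
Qed.

Lemma cone_diff_diff n (v : X (succz n) * Y n) : cone_diff (cone_diff v) = 0.
Proof.
apply/pair_equal_spec; split=> /=; first by rewrite linearN diff_diff !oppr0.
by rewrite linearN linearD chain_comm diff_diff addr0 addNr.
Qed.

Lemma cone_bounded : exists N : nat, forall n : int, (N < `|n|)%N ->
  forall v : X (succz n) * Y n, v = 0.
Proof.
have [N bN] := bounded X; have [N' bN'] := bounded Y.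
exists (maxn N.+1 N') => n nN [x y].
by rewrite (bN _ _ x) ?(bN' _ _ y) // /succz; lia.
Qed.

Definition cone : perfect R :=
  @Perfect R (fun n => prod_module (X (succz n)) (Y n))
    (fun n => mk_linear (@cone_diff_linear n)) cone_diff_diff cone_bounded.

Lemma cone_in_linear n : linear (fun y : Y n => (0, y) : cone n).
Proof. by move=> c y y'; rewrite pair_linE scaler0 addr0. Qed.

Lemma cone_out_linear n : linear (fun v : cone n => v.1 : suspension X n).
Proof. by move=> c v v'. Qed.

Lemma cone_in_comm n (y : Y n) :
  ((0, diff Y n y) : cone (succz n)) = diff cone n ((0, y) : cone n).
Proof. by rewrite /= /cone_diff linear0 oppr0 linear0 add0r. Qed.

Definition cone_in : chain_map Y cone :=
  @ChainMap R Y cone (fun n => mk_linear (@cone_in_linear n)) cone_in_comm.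

Lemma cone_out_comm n (v : cone n) :
  (diff cone n v).1 = diff (suspension X) n v.1.
Proof. by []. Qed.

Definition cone_out : chain_map cone (suspension X) :=
  @ChainMap R cone (suspension X) (fun n => mk_linear (@cone_out_linear n)) cone_out_comm.
End Cone.

(* A triangle is exact when it is isomorphic, in the homotopy category, to
   X -> Y -> cone u -> suspension X for some chain map u : X -> Y. *)
Definition exact_triangle A B C (f : chain_map A B) (g : chain_map B C)
    (h : chain_map C (suspension A)) : Prop :=
  exists (X Y : perfect R) (u : chain_map X Y)
         (a : chain_map A X) (b : chain_map B Y) (c : chain_map C (cone u)),
    [/\ homotopy_equivalence a, homotopy_equivalence b & homotopy_equivalence c] /\
    [/\ homotopic (chain_comp b f) (chain_comp u a),
        homotopic (chain_comp c g) (chain_comp (cone_in u) b) &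
        homotopic (chain_comp (suspension_map a) h) (chain_comp (cone_out u) c)].

(** ** The ring as a complex, and Moore complexes *)

Definition ring_term (n : int) : proj_module R :=
  if n is Posz 0 then regular_module R else zero_module R.

Definition ring_diff n : {linear ring_term n -> ring_term (succz n)} := \0.

Lemma ring_diff_diff n (x : ring_term n) : ring_diff (succz n) (ring_diff n x) = 0.
Proof. by []. Qed.

Lemma ring_bounded : exists N : nat, forall n : int, (N < `|n|)%N ->
  forall x : ring_term n, x = 0.
Proof. by exists 0%N => -[[|n]|n] //= _ x; apply/rowP => -[]. Qed.

Definition ring_complex : perfect R := @Perfect R ring_term ring_diff ring_diff_diff ring_bounded.

Lemma scalar_map_comm (a : R) X n (x : X n) : a *: diff X n x = diff X n (a *: x).
Proof. by rewrite linearZ. Qed.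

Definition scalar_map (a : R) X : chain_map X X :=
  @ChainMap R X X (fun n => *:%R a) (@scalar_map_comm a X).

Definition moore (a : R) : perfect R := cone (scalar_map a ring_complex).

(** ** Supports *)

(* Exactness at X (succz n), for all n. *)
Definition acyclic (X : int -> lmodType R)
    (d : forall n, {linear X n -> X (succz n)}) : Prop :=
  forall n (x : X (succz n)), d (succz n) x = 0 -> exists y : X n, d n y = x.

(* M ⊗ R_p is identified with the localised module [loc p M]; the complex
   X ⊗ R_p is zero in the derived category when it is acyclic. *)
Definition supp X : set (spec R) :=
  [set p | ~ acyclic (fun n => loc_map p (diff X n))].

(** ** Isomorphism classes of objects *)

Lemma homotopic_refl X Y (f : chain_map X Y) : homotopic f f.
Proof. by exists (fun n => \0) => n x; rewrite /= subrr linear0 addr0. Qed.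

Lemma homotopic_sym X Y (f g : chain_map X Y) : homotopic f g -> homotopic g f.
Proof.
move=> [h hP]; exists (fun n => \- h n) => n x.
by rewrite /= linearN -opprB hP opprD.
Qed.

Lemma homotopic_trans X Y (g f k : chain_map X Y) :
  homotopic f g -> homotopic g k -> homotopic f k.
Proof.
move=> [h hP] [h' hP']; exists (fun n => h n \+ h' n) => n x.
by rewrite /= linearD addrACA -hP -hP' addrA subrK.
Qed.

Lemma homotopic_comp X Y Z (g g' : chain_map Y Z) (f f' : chain_map X Y) :
  homotopic g g' -> homotopic f f' -> homotopic (chain_comp g f) (chain_comp g' f').
Proof.
move=> gg' [h hP]; apply: (@homotopic_trans _ _ (chain_comp g f')).
  exists (fun n => g n \o h n) => n x /=.
  by rewrite -linearB hP linearD chain_comm.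
have [k kP] := gg'; exists (fun n => k n \o f' (succz n)) => n x /=.
by rewrite kP chain_comm.
Qed.

Lemma chain_comp1 X Y (f : chain_map X Y) : homotopic (chain_comp f (chain_id X)) f.
Proof. by exists (fun n => \0) => n x; rewrite /= subrr linear0 addr0. Qed.

Lemma homotopy_equivalence_id X : homotopy_equivalence (chain_id X).
Proof. by exists (chain_id X); split; apply: chain_comp1. Qed.

Lemma homotopy_equivalence_comp X Y Z (g : chain_map Y Z) (f : chain_map X Y) :
  homotopy_equivalence g -> homotopy_equivalence f -> homotopy_equivalence (chain_comp g f).
Proof.
move=> [g' [g'g gg']] [f' [f'f ff']]; exists (chain_comp f' g'); split.
  have H := homotopic_comp (homotopic_refl f') (homotopic_comp g'g (homotopic_refl f)).
  exact: homotopic_trans H f'f.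
have H := homotopic_comp (homotopic_refl g) (homotopic_comp ff' (homotopic_refl g')).
exact: homotopic_trans H gg'.
Qed.

Lemma isomorphic_refl X : isomorphic X X.
Proof. by exists (chain_id X); apply: homotopy_equivalence_id. Qed.

Lemma isomorphic_sym X Y : isomorphic X Y -> isomorphic Y X.
Proof. by move=> [f [g [gf fg]]]; exists g, f. Qed.

Lemma isomorphic_trans Y X Z : isomorphic X Y -> isomorphic Y Z -> isomorphic X Z.
Proof. by move=> [f ef] [g eg]; exists (chain_comp g f); apply: homotopy_equivalence_comp. Qed.
End Complexes.

(** * Abelian groups *)

(* The objects of the derived category are built from arbitrary [lmodType]s, so
   they form a type that is too large to carry a MathComp structure: neither
   [{freeg K / int}] nor [zmodType] applies to K_0, which is therefore built
   from this record. *)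
Record ab_group := AbGroup {
  ab_sort :> Type;
  ab_zero : ab_sort;
  ab_opp : ab_sort -> ab_sort;
  ab_add : ab_sort -> ab_sort -> ab_sort;
  ab_addA : forall x y z, ab_add x (ab_add y z) = ab_add (ab_add x y) z;
  ab_addC : forall x y, ab_add x y = ab_add y x;
  ab_add0 : forall x, ab_add ab_zero x = x;
  ab_addN : forall x, ab_add (ab_opp x) x = ab_zero
}.

Definition int_group : ab_group := AbGroup (@addrA int) (@addrC int) (@add0r int) (@addNr int).

Definition ab_isomorphism (G H : ab_group) (f : G -> H) : Prop :=
  [/\ forall x y, f (ab_add x y) = ab_add (f x) (f y),
      forall x y, f x = f y -> x = y
    & forall z, exists x, f x = z].

Definition ab_subgroup (G : ab_group) (H : G -> Prop) : Prop :=
  [/\ H (ab_zero G), forall x y, H x -> H y -> H (ab_add x y)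
    & forall x, H x -> H (ab_opp x)].

Definition generated_subgroup (G : ab_group) (A : G -> Prop) (x : G) : Prop :=
  forall H : G -> Prop, ab_subgroup H -> (forall a, A a -> H a) -> H x.

Lemma generated_subgroupP (G : ab_group) (A : G -> Prop) : ab_subgroup (generated_subgroup A).
Proof.
split=> [H [] //|x y Hx Hy H sH AH|x Hx H sH AH]; case: (sH) => _ HD HN.
  by apply: HD; [exact: (Hx H) | exact: (Hy H)].
by apply: HN; exact: (Hx H).
Qed.

(** ** Quotients *)

Section Quotient.
Variables (T : Type) (r : T -> T -> Prop).

(* For an equivalence relation r: the type of its equivalence classes. *)
Definition quotient : Type := {A : T -> Prop | exists x, A = r x}.

Definition quot_class (x : T) : quotient := exist _ (r x) (ex_intro _ x erefl).

Definition quot_repr (a : quotient) : T := sval (cid (svalP a)).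

Lemma quotient_eq (a b : quotient) : sval a = sval b -> a = b.
Proof.
case: a b => A hA [B hB] /= AB; case: B / AB in hB *.
by rewrite (Prop_irrelevance hA hB).
Qed.

Lemma quot_reprK a : quot_class (quot_repr a) = a.
Proof. by apply: quotient_eq; rewrite /= /quot_repr; case: cid. Qed.

Hypotheses (r_refl : forall x, r x x) (r_sym : forall x y, r x y -> r y x)
  (r_trans : forall y x z, r x y -> r y z -> r x z).

Lemma quot_classP x y : quot_class x = quot_class y <-> r x y.
Proof.
split=> [e | xy].
  have e' : r x = r y := congr1 sval e.
  by rewrite e'; apply: r_refl.
apply: quotient_eq; apply: funext => z; apply: propext; split; last exact: r_trans.
by apply: r_trans; apply: r_sym.
Qed.
End Quotient.

Section QuotientGroup.
Variables (G : ab_group) (H : G -> Prop) (sH : ab_subgroup H).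

Local Notation "x + y" := (ab_add x y).
Local Notation "- x" := (ab_opp x).

Definition same_coset (x y : G) : Prop := H (x + - y).

Lemma ab_add0r (x : G) : x + ab_zero G = x. Proof. by rewrite ab_addC ab_add0. Qed.

Lemma ab_addNr (x : G) : x + - x = ab_zero G. Proof. by rewrite ab_addC ab_addN. Qed.

Lemma ab_addCA (x y z : G) : x + (y + z) = y + (x + z).
Proof. by rewrite ab_addA (ab_addC x) -ab_addA. Qed.

Lemma ab_addACA (x y z t : G) : (x + y) + (z + t) = (x + z) + (y + t).
Proof. by rewrite -!ab_addA (ab_addCA y). Qed.

Lemma ab_opp_uniq (x y : G) : x + y = ab_zero G -> y = - x.
Proof. by move=> xy; rewrite -[LHS]ab_add0 -(ab_addN x) -ab_addA xy ab_add0r. Qed.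

Lemma ab_oppK (x : G) : - - x = x.
Proof. by symmetry; apply: ab_opp_uniq; apply: ab_addN. Qed.

Lemma ab_oppD (x y : G) : - (x + y) = - x + - y.
Proof. by symmetry; apply: ab_opp_uniq; rewrite ab_addACA !ab_addNr ab_add0. Qed.

Lemma same_coset_refl x : same_coset x x.
Proof. by rewrite /same_coset ab_addNr; case: sH. Qed.

Lemma same_coset_sym x y : same_coset x y -> same_coset y x.
Proof.
case: sH => _ _ HN /HN; rewrite /same_coset ab_oppD ab_oppK.
by rewrite ab_addC.
Qed.

Lemma same_coset_trans y x z : same_coset x y -> same_coset y z -> same_coset x z.
Proof.
case: sH => _ HD _ xy yz; have := HD _ _ xy yz.
by rewrite /same_coset -ab_addA (ab_addA (- y)) ab_addN ab_add0.
Qed.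

Definition coset_class : G -> quotient same_coset := quot_class same_coset.

Lemma coset_classP x y : coset_class x = coset_class y <-> H (x + - y).
Proof. exact: (quot_classP same_coset_refl same_coset_sym same_coset_trans). Qed.

Definition quot_add (a b : quotient same_coset) := coset_class (quot_repr a + quot_repr b).
Definition quot_opp (a : quotient same_coset) := coset_class (- quot_repr a).

Lemma coset_repr x : same_coset (quot_repr (coset_class x)) x.
Proof. by apply/coset_classP; apply: quot_reprK. Qed.

Lemma quot_add_class x y : quot_add (coset_class x) (coset_class y) = coset_class (x + y).
Proof.
apply/coset_classP; rewrite ab_oppD ab_addACA.
by case: sH => _ HD _; apply: HD; apply: coset_repr.
Qed.

Lemma quot_opp_class x : quot_opp (coset_class x) = coset_class (- x).
Proof.
apply/coset_classP; rewrite -ab_oppD.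
by case: sH => _ _ HN; apply: HN; apply: coset_repr.
Qed.

Lemma quot_ind (P : quotient same_coset -> Prop) : (forall x, P (coset_class x)) -> forall a, P a.
Proof. by move=> Px a; rewrite -[a]quot_reprK. Qed.

Lemma quot_addA a b c : quot_add a (quot_add b c) = quot_add (quot_add a b) c.
Proof.
by elim/quot_ind: a => x; elim/quot_ind: b => y; elim/quot_ind: c => z;
   rewrite !quot_add_class ab_addA.
Qed.

Lemma quot_addC a b : quot_add a b = quot_add b a.
Proof.
by elim/quot_ind: a => x; elim/quot_ind: b => y; rewrite !quot_add_class ab_addC.
Qed.

Lemma quot_add0 a : quot_add (coset_class (ab_zero G)) a = a.
Proof. by elim/quot_ind: a => x; rewrite quot_add_class ab_add0. Qed.

Lemma quot_addN a : quot_add (quot_opp a) a = coset_class (ab_zero G).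
Proof. by elim/quot_ind: a => x; rewrite quot_opp_class quot_add_class ab_addN. Qed.

Definition quotient_group : ab_group := AbGroup quot_addA quot_addC quot_add0 quot_addN.
End QuotientGroup.

(** ** Free abelian groups *)

Section FreeAbelian.
Variable I : Type.

Record fin_supp := FinSupp {
  coef :> I -> int;
  coef_finite : exists s : list I, forall i, coef i <> 0 -> List.In i s
}.

Lemma fin_suppP (v w : fin_supp) : (forall i, v i = w i) -> v = w.
Proof.
case: v w => v hv [w hw] /= /funext vw.
by case: w / vw in hw *; rewrite (Prop_irrelevance hv hw).
Qed.

Lemma zero_finite : exists s : list I, forall i, (0 : int) <> 0 -> List.In i s.
Proof. by exists nil. Qed.

Definition fs_zero : fin_supp := @FinSupp (fun=> 0) zero_finite.

Lemma opp_finite (v : fin_supp) : exists s : list I, forall i, - v i <> 0 -> List.In i s.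
Proof.
case: (coef_finite v) => s vs; exists s => i vi; apply: vs => vi0.
by apply: vi; rewrite vi0 oppr0.
Qed.

Definition fs_opp v : fin_supp := FinSupp (opp_finite v).

Lemma add_finite (v w : fin_supp) :
  exists s : list I, forall i, v i + w i <> 0 -> List.In i s.
Proof.
case: (coef_finite v) => s vs; case: (coef_finite w) => t wt.
exists (app s t) => i vwi; apply/List.in_or_app.
have [vi0|/eqP/vs] := eqVneq (v i) 0; last by left.
by right; apply: wt => wi0; apply: vwi; rewrite vi0 wi0 addr0.
Qed.

Definition fs_add v w : fin_supp := FinSupp (add_finite v w).

Lemma fs_addA u v w : fs_add u (fs_add v w) = fs_add (fs_add u v) w.
Proof. by apply: fin_suppP => i /=; rewrite addrA. Qed.

Lemma fs_addC v w : fs_add v w = fs_add w v.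
Proof. by apply: fin_suppP => i /=; rewrite addrC. Qed.

Lemma fs_add0 v : fs_add fs_zero v = v.
Proof. by apply: fin_suppP => i /=; rewrite add0r. Qed.

Lemma fs_addN v : fs_add (fs_opp v) v = fs_zero.
Proof. by apply: fin_suppP => i /=; rewrite addNr. Qed.

Definition free_group : ab_group := AbGroup fs_addA fs_addC fs_add0 fs_addN.

Lemma gen_finite (i : I) :
  exists s : list I, forall j, (`[< i = j >] : nat)%:Z <> 0 -> List.In j s.
Proof. by exists (cons i nil) => j; case: asboolP => // ij _; left. Qed.

Definition free_gen (i : I) : free_group := FinSupp (gen_finite i).
End FreeAbelian.

Definition infinite_cyclic_on (G : ab_group) (e : G) : Prop :=
  exists f : int_group -> G, ab_isomorphism f /\ f 1 = e.

Definition free_abelian_on (G : ab_group) (I : Type) (e : I -> G) : Prop :=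
  exists f : free_group I -> G, ab_isomorphism f /\ forall i, f (free_gen i) = e i.

(** * The Grothendieck group of complexes supported on S *)

Section GrothendieckGroup.
Variables (R : idomainType) (S : set (spec R)).

Definition supported_complex : Type := {X : perfect R | supp X `<=` S}.
Implicit Types A B C : supported_complex.

Definition supported X (hX : supp X `<=` S) : supported_complex := exist _ X hX.

Definition iso_class : Type := quotient (fun A B => isomorphic (sval A) (sval B)).

Definition object_gen A : free_group iso_class := free_gen (quot_class _ A).

(* The elements [B] - ([A] + [C]), for exact triangles A -> B -> C -> suspension A. *)
Definition triangle_relation (w : free_group iso_class) : Prop :=
  exists A B C (f : chain_map (sval A) (sval B)) (g : chain_map (sval B) (sval C))
         (h : chain_map (sval C) (suspension (sval A))),
    exact_triangle f g h /\
    w = ab_add (object_gen B) (ab_opp (ab_add (object_gen A) (object_gen C))).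

Definition K0 : ab_group := quotient_group (generated_subgroupP triangle_relation).

Definition K0_class A : K0 := coset_class _ (object_gen A).
End GrothendieckGroup.

(* Main.v *)
(* A perfect complex X has, at each prime q, an Euler characteristic chi_q(X): the
   alternating sum of the lengths of the localised cohomology modules H^n(X)_q.
   Whenever these lengths are finite, chi_q is additive on exact triangles, by the
   long exact sequence.  At q = 0 it is the rank, and chi_0(R) = 1; at a prime
   q = (p) in S it is the p-length, and chi_q(M(p')) is 1 if q = (p') and 0 otherwise.
   This separates the classes of the proposed generators.

   That they generate is proved by devissage.  If n is the top degree of X and
   X^n <> 0, choose a surjection e : X^n -> R and let (a) be the image of e d.  If
   a <> 0, then (e d / a, e) is a degreewise split surjection of X onto the complex
   R -a-> R in degrees n - 1, n, and the primes containing a lie in supp X; if a = 0,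
   then e is a surjection of X onto R placed in degree n, and 0 lies in supp X.  The
   kernel has smaller rank in degree n.  Finally the octahedral axiom gives
   [M(ab)] = [M(a)] + [M(b)], which reduces to prime a. *)
Require Import Defs.
From mathcomp Require Import all_boot all_order all_algebra.
From mathcomp Require Import all_classical.
From mathcomp Require Import ring zify.
From HB Require Import structures.
From Stdlib Require List Permutation.

Set Implicit Arguments.
Unset Strict Implicit.
Unset Printing Implicit Defensive.

Import GRing.Theory.

Local Open Scope classical_set_scope.
Local Open Scope ring_scope.

Local Notation "x +g y" := (ab_add x y) (at level 50, left associativity).

(** * Abelian groups and the Grothendieck group *)

(** The obstacle is finiteness: lengths at q may be infinite, and chi_q is additive only where they
    are finite. The devissage settles this too. It is stated for an arbitrary class of complexes
    closed under isomorphism and under two-out-of-three for cones. It is then applied both to the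
    complexes with finite lengths at q and to those whose K_0-class lies in the subgroup spanned by
    the generators. Finiteness thus has to be checked only on R at the zero prime, or on the M(p) at
    primes of S, where the cohomology is R or R / (p). Length is measured by chains of submodules of
    the original modules, where a step counts only if it survives localisation at q. The long exact
    sequence then becomes three families of isomorphisms between subquotients, along which chains
    are transported. *)

Definition ab_hom (G H : ab_group) (f : G -> H) : Prop :=
  forall x y, f (x +g y) = f x +g f y.

Section AbelianGroups.
Variable G : ab_group.

Lemma ab_addNKr (x y : G) : x +g (ab_opp x +g y) = y.
Proof. by rewrite ab_addA ab_addNr ab_add0. Qed.

Lemma ab_addI (x y z : G) : x +g y = x +g z -> y = z.
Proof. by move=> e; rewrite -(ab_add0 y) -(ab_add0 z) -(ab_addN x) -!ab_addA e. Qed.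

Lemma ab_opp0 : ab_opp (ab_zero G) = ab_zero G.
Proof. by symmetry; apply: ab_opp_uniq; rewrite ab_add0. Qed.

Lemma ab_subr_eq0 (x y : G) : x +g ab_opp y = ab_zero G -> x = y.
Proof. by move=> e; rewrite -(ab_add0 y) -e -ab_addA ab_addN ab_add0r. Qed.

Fixpoint nmul n (x : G) : G := if n is n'.+1 then x +g nmul n' x else ab_zero G.

Definition zmul (m : int) (x : G) : G :=
  match m with Posz n => nmul n x | Negz n => ab_opp (nmul n.+1 x) end.

Lemma zmulS m x : zmul (m + 1) x = x +g zmul m x.
Proof.
case: m => [n|[|n]]; first by rewrite -PoszD addn1.
  by rewrite /= ab_add0r ab_addNr.
rewrite (_ : Negz n.+1 + 1 = Negz n); last by lia.
by rewrite /= !ab_oppD ab_addNKr.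
Qed.

Lemma zmulD m n x : zmul (m + n) x = zmul m x +g zmul n x.
Proof.
elim/int_ind: m => [|m IH|m IH]; first by rewrite add0r /= ab_add0.
  by rewrite -addn1 PoszD addrAC !zmulS IH ab_addA.
apply: (@ab_addI x); rewrite ab_addA -!zmulS -addn1 PoszD.
have -> : - (m%:Z + 1) + n + 1 = - m%:Z + n by lia.
by have -> : - (m%:Z + 1) + 1 = - m%:Z by lia.
Qed.

Lemma zmul1 x : zmul 1 x = x.
Proof. by rewrite /= ab_add0r. Qed.

End AbelianGroups.

Section Homs.
Variables (G H : ab_group) (f : G -> H).
Hypothesis hf : ab_hom f.

Lemma hom0 : f (ab_zero G) = ab_zero H.
Proof. by apply: (@ab_addI _ (f (ab_zero G))); rewrite -hf ab_add0 ab_add0r. Qed.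

Lemma homN x : f (ab_opp x) = ab_opp (f x).
Proof. by apply: ab_opp_uniq; rewrite -hf ab_addNr hom0. Qed.

Lemma hom_injective : (forall x, f x = ab_zero H -> x = ab_zero G) ->
  forall x y, f x = f y -> x = y.
Proof. by move=> K x y e; apply: ab_subr_eq0; apply: K; rewrite hf homN e ab_addNr. Qed.

Lemma hom_image_subgroup : ab_subgroup (fun y => exists x, f x = y).
Proof.
split; first by exists (ab_zero G); apply: hom0.
  by move=> _ _ [x <-] [y <-]; exists (x +g y).
by move=> _ [x <-]; exists (ab_opp x); apply: homN.
Qed.
End Homs.

Lemma hom_equalizer (G H : ab_group) (f g : G -> H) : ab_hom f -> ab_hom g ->
  ab_subgroup (fun x => f x = g x).
Proof.
move=> hf hg; split; first by rewrite !hom0.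
  by move=> x y ex ey; rewrite hf hg ex ey.
by move=> x ex; rewrite !homN // ex.
Qed.

Section FreeGroup.
Variables (I : Type) (G : ab_group) (e : I -> G).
Local Notation F := (free_group I).

Definition lin_comb (v : I -> int) (s : list I) : G :=
  List.fold_right (fun i x => zmul (v i) (e i) +g x) (ab_zero G) s.

Lemma lin_comb_perm v s t : Permutation.Permutation s t -> lin_comb v s = lin_comb v t.
Proof.
elim=> {s t} [//|i s t _ /= -> //|i j s /=|s t u _ -> _ -> //].
exact: ab_addCA.
Qed.

Lemma lin_comb_filter v s : lin_comb v s = lin_comb v (List.filter (fun i => v i != 0) s).
Proof. by elim: s => //= i s IH; case: eqP => [->|_] /=; rewrite IH ?ab_add0. Qed.

Definition covers (s : list I) (v : I -> int) := forall i, v i <> 0 -> List.In i s.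

(** Once zero coefficients are filtered out, two repetition-free covers have the same members, so
    they are permutations of each other. *)
Lemma lin_comb_uniq v s t : List.NoDup s -> List.NoDup t -> covers s v -> covers t v ->
  lin_comb v s = lin_comb v t.
Proof.
move=> us ut cs ct; rewrite lin_comb_filter [RHS]lin_comb_filter.
apply: lin_comb_perm; apply: Permutation.NoDup_Permutation; try exact: List.NoDup_filter.
by move=> i; rewrite !List.filter_In; split=> -[_ /eqP vi]; split; auto; apply/eqP.
Qed.

Lemma exists_cover (v : F) : exists s, List.NoDup s /\ covers s v.
Proof.
have [s vs] := coef_finite v; have dec (x y : I) : {x = y} + {x <> y} by exact: pselect.
exists (List.nodup dec s); split; first exact: List.NoDup_nodup.
by move=> i vi; apply/List.nodup_In; apply: vs.
Qed.

Definition cover (v : F) : list I := sval (cid (exists_cover v)).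

Lemma coverP v : List.NoDup (cover v) /\ covers (cover v) v.
Proof. by rewrite /cover; case: cid. Qed.

Definition free_lift (v : F) : G := lin_comb v (cover v).

Lemma lin_combD (v w : I -> int) s :
  lin_comb (fun i => v i + w i) s = lin_comb v s +g lin_comb w s.
Proof.
elim: s => [|i s IH] /=; first by rewrite ab_add0.
by rewrite zmulD IH ab_addACA.
Qed.

Lemma free_lift_hom : ab_hom free_lift.
Proof.
move=> v w; have dec (x y : I) : {x = y} + {x <> y} by exact: pselect.
pose s := List.nodup dec (cover v ++ cover w)%list.
have us : List.NoDup s by exact: List.NoDup_nodup.
have [uv cv] := coverP v; have [uw cw] := coverP w; have [uvw cvw] := coverP (v +g w).
have sv : covers s v by move=> i /cv vi; apply/List.nodup_In/List.in_or_app; left.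
have sw : covers s w by move=> i /cw wi; apply/List.nodup_In/List.in_or_app; right.
have svw : covers s (v +g w : F).
  move=> i /= vw; have [v0|/eqP/sv//] := eqVneq (v i) 0.
  by apply: sw => w0; apply: vw; rewrite v0 w0 addr0.
rewrite /free_lift (lin_comb_uniq uvw us cvw svw) (lin_comb_uniq uv us cv sv).
by rewrite (lin_comb_uniq uw us cw sw) -lin_combD.
Qed.

Lemma free_lift_gen i : free_lift (free_gen i) = e i.
Proof.
have [u c] := coverP (free_gen i).
rewrite /free_lift (@lin_comb_uniq _ _ (i :: nil) u) //.
- by rewrite /= asboolT //= !ab_add0r.
- by constructor; [case | constructor].
- by move=> j /=; case: asboolP => // ->; left.
Qed.
End FreeGroup.

Lemma free_group_ind (I : Type) (H : free_group I -> Prop) : ab_subgroup H ->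
  (forall i, H (free_gen i)) -> forall v, H v.
Proof.
move=> [H0 HD HN] Hg v.
have Hz m i : H (zmul m (free_gen i)).
  have Hn n : H (nmul n (free_gen i)) by elim: n => [|n IH] //=; apply: HD.
  by case: m => n; [exact: Hn | apply: HN; exact: Hn].
have coef_zmul m i j : coef (zmul m (free_gen i)) j = m * (`[< i = j >] : nat)%:Z.
  have hn n : coef (nmul n (free_gen i)) j = n%:Z * (`[< i = j >] : nat)%:Z.
    by elim: n => [|n IH] /=; [rewrite mul0r | rewrite IH; lia].
  case: m => n; first exact: hn.
  by rewrite /= hn; lia.
have [s [us cs]] := exists_cover v; elim: s v us cs => [|i s IH] v us cs.
  rewrite (_ : v = ab_zero _) //; apply: fin_suppP => i /=.
  by apply/eqP/negPn/negP => /eqP/cs.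
(* Removing the coefficient at [i] leaves an element whose support is covered by the tail [s]. *)
have -> : v = zmul (v i) (free_gen i) +g (v +g ab_opp (zmul (v i) (free_gen i))).
  by rewrite ab_addCA ab_addNr ab_add0r.
apply: HD => //; apply: IH; first by inversion us.
move=> j /=; rewrite coef_zmul; case: asboolP => [<-|ij]; first by rewrite mulr1 subrr.
by rewrite mulr0 subr0 => /cs[].
Qed.

(** * The universal property of K_0 *)

Section GrothendieckGroups.
Variables (R : idomainType) (S : set (spec R)).
Local Notation T := (supported_complex S).
Local Notation isoT := (fun A B : T => isomorphic (sval A) (sval B)).

Lemma iso_classP (A B : T) : quot_class isoT A = quot_class isoT B <-> isomorphic (sval A) (sval B).
Proof.
apply: quot_classP.
- by move=> X; apply: isomorphic_refl.
- by move=> X Y; apply: isomorphic_sym.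
- by move=> X Y Z; apply: isomorphic_trans.
Qed.

Lemma K0_class_iso (A B : T) : isomorphic (sval A) (sval B) -> K0_class A = K0_class B.
Proof. by move=> /iso_classP AB; rewrite /K0_class /object_gen AB. Qed.

Lemma K0_addE (x y : free_group (iso_class S)) :
  coset_class (generated_subgroup (@triangle_relation R S)) (x +g y)
  = (coset_class _ x : K0 S) +g (coset_class _ y : K0 S).
Proof. by rewrite /= quot_add_class //; apply: generated_subgroupP. Qed.

Lemma K0_triangle (A B C : T) (f : chain_map (sval A) (sval B)) (g : chain_map (sval B) (sval C))
    (h : chain_map (sval C) (suspension (sval A))) :
  exact_triangle f g h -> K0_class B = K0_class A +g K0_class C.
Proof.
move=> t; rewrite /K0_class -K0_addE; apply/coset_classP; first exact: generated_subgroupP.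
by move=> H sH; apply; exists A, B, C, f, g, h.
Qed.

Lemma K0_ind (H : K0 S -> Prop) : ab_subgroup H -> (forall A, H (K0_class A)) -> forall x, H x.
Proof.
move=> [H0 HD HN] Hc x; rewrite -[x]quot_reprK; move: (quot_repr x).
apply: free_group_ind; last by move=> i; rewrite -[i]quot_reprK; exact: Hc.
split; first exact: H0.
  by move=> v w Hv Hw; rewrite -/(coset_class _ _) K0_addE; apply: HD.
move=> v Hv; have := HN _ Hv; rewrite /= -/(coset_class _ _) quot_opp_class //.
exact: generated_subgroupP.
Qed.

(** Since [chi] respects isomorphism, its values on chosen representatives extend linearly to the
    free group. The extension sends the triangle relations to zero, so it is constant on cosets. *)
Lemma K0_lift (G : ab_group) (chi : T -> G) :
  (forall A B, isomorphic (sval A) (sval B) -> chi A = chi B) ->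
  (forall A B C (f : chain_map (sval A) (sval B)) (g : chain_map (sval B) (sval C))
     (h : chain_map (sval C) (suspension (sval A))),
     exact_triangle f g h -> chi B = chi A +g chi C) ->
  exists F : K0 S -> G, ab_hom F /\ forall A, F (K0_class A) = chi A.
Proof.
move=> chi_iso chi_tri.
pose ev := @free_lift (iso_class S) G (fun c => chi (quot_repr c)).
have hev : ab_hom ev := @free_lift_hom _ _ _.
have ev_gen A : ev (object_gen A) = chi A.
  rewrite /ev /object_gen free_lift_gen; apply: chi_iso.
  by apply/iso_classP; exact: quot_reprK.
have ev0 w : generated_subgroup (@triangle_relation R S) w -> ev w = ab_zero G.
  move=> /(_ (fun w => ev w = ab_zero G)); apply=> [|_ [A [B [C [f [g [h [t ->]]]]]]]].
    split; first exact: hom0.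
      by move=> x y; rewrite hev => -> ->; rewrite ab_add0.
    by move=> x; rewrite homN // => ->; rewrite ab_opp0.
  by rewrite hev homN // hev !ev_gen (chi_tri _ _ _ _ _ _ t) ab_addNr.
have ev_coset v : ev (quot_repr (coset_class (generated_subgroup (@triangle_relation R S)) v)) = ev v.
  apply: ab_subr_eq0; rewrite -homN // -hev; apply: ev0.
  by apply: (@coset_repr _ _ (generated_subgroupP _)).
exists (fun x : K0 S => ev (quot_repr x)); split=> [x y|A]; last by rewrite /K0_class ev_coset.
by rewrite /= /quot_add ev_coset hev.
Qed.
End GrothendieckGroups.

(** * Localised length *)

Section Length.
Variables (R : idomainType) (q : spec R).

Lemma prime_notin1 : 1 \notin q.
Proof. by case: (prime_ideal q). Qed.

Lemma prime_notinM s t : s \notin q -> t \notin q -> s * t \notin q.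
Proof.
move=> hs ht; apply/negP => /(@prime_prime R q _ _) /orP[] h.
  by rewrite h in hs.
by rewrite h in ht.
Qed.

Lemma prime_mulr s t : t \in q -> s * t \in q.
Proof.
case: (prime_ideal q) => q0 _ /(_ s t 0) h ht.
by have := h ht q0; rewrite addr0.
Qed.

Definition submod (M : lmodType R) (A : M -> Prop) : Prop :=
  A 0 /\ forall a x y, A x -> A y -> A (a *: x + y).

Section OneModule.
Variable M : lmodType R.
Implicit Types A B C D E : M -> Prop.

Lemma submodD A x y : submod A -> A x -> A y -> A (x + y).
Proof. by move=> [_ h] Ax Ay; rewrite -[x]scale1r; apply: h. Qed.

Lemma submodZ A a x : submod A -> A x -> A (a *: x).
Proof. by move=> [h0 h] Ax; rewrite -[_ *: _]addr0; apply: h. Qed.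

Lemma submodN A x : submod A -> A x -> A (- x).
Proof. by move=> sA Ax; rewrite -scaleN1r; apply: submodZ. Qed.

Lemma submodB A x y : submod A -> A x -> A y -> A (x - y).
Proof. by move=> sA Ax Ay; apply: submodD => //; apply: submodN. Qed.

(* For A contained in B: the localisations of A and B at q agree. *)
Definition dense A B : Prop := forall x, B x -> exists2 s, s \notin q & A (s *: x).

(** Only steps that stay proper after localisation count, so the largest k is the length of the
    localised quotient. The final inclusion into B may be an equality, which lets a chain be reused
    for larger B or smaller A. *)
Fixpoint chain k A B : Prop :=
  if k is k'.+1 then
    exists C, [/\ submod C, A `<=` C, C `<=` B, ~ dense A C & chain k' C B]
  else A `<=` B.

Lemma chain_sub k A B : chain k A B -> A `<=` B.
Proof.
elim: k A => [//|k IH] A [C [_ AC _ _ /IH CB]]; exact: subset_trans CB.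
Qed.

Lemma chain_mono k A A' B B' : A `<=` A' -> B' `<=` B -> chain k A' B' -> chain k A B.
Proof.
elim: k A A' => [|k IH] A A' AA' BB' /=.
  by move=> h x /AA'/h/BB'.
move=> [C [sC A'C CB nd ch]]; exists C; split=> //.
- exact: subset_trans A'C.
- exact: subset_trans BB'.
- by move=> d; apply: nd => x /d[s hs /AA' ?]; exists s.
- exact: IH ch.
Qed.

Lemma chain_cat j k A B C : chain j A B -> chain k B C -> chain (j + k) A C.
Proof.
elim: j A => [|j IH] A /=; first by move=> AB; apply: chain_mono.
move=> [D [sD AD DB nd ch]] ch'; exists D; split=> //; last exact: IH.
exact: subset_trans (chain_sub ch').
Qed.

Definition sum_mod A B : M -> Prop := fun x => exists y z, [/\ A y, B z & x = y + z].

Lemma sum_mod_submod A B : submod A -> submod B -> submod (sum_mod A B).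
Proof.
move=> sA sB; split; first by exists 0, 0; split; [case: sA|case: sB|rewrite addr0].
move=> a _ _ [y [z [Ay Bz ->]]] [y' [z' [Ay' Bz' ->]]].
exists (a *: y + y'), (a *: z + z'); split; [by apply: sA.2 | by apply: sB.2 |].
by rewrite scalerDr addrACA.
Qed.

Lemma setI_submod A B : submod A -> submod B -> submod (A `&` B).
Proof.
move=> sA sB; split; first by split; [case: sA|case: sB].
by move=> a x y [Ax Bx] [Ay By]; split; [apply: sA.2 | apply: sB.2].
Qed.

(* A strict step D < D' stays strict after intersecting with E or after adding E,
   so the chain splits without any appeal to Jordan-Hoelder. *)
Lemma chain_modular k D C E : submod D -> submod C -> submod E -> chain k D C ->
  exists i j, [/\ chain i (D `&` E) (C `&` E), chain j (sum_mod D E) (sum_mod C E) & (k <= i + j)%N].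
Proof.
move=> sD sC sE; elim: k D sD => [|k IH] D sD.
  move=> /= DC; exists 0%N, 0%N; split=> //= x; first by case=> /DC.
  by move=> [y [z [/DC Cy Ez ->]]]; exists y, z.
move=> /= [D' [sD' DD' D'C nd ch]].
have [i [j [ci cj kij]]] := IH _ sD' ch.
have DEI : D `&` E `<=` D' `&` E by move=> x [/DD'].
have DES : sum_mod D E `<=` sum_mod D' E by move=> x [y [z [/DD' ? ? ->]]]; exists y, z.
have [dI|ndI] := pselect (dense (D `&` E) (D' `&` E)); last first.
  exists i.+1, j; split; [|exact: chain_mono cj|by rewrite addSn].
  by exists (D' `&` E); split=> //; [exact: setI_submod | move=> x [/D'C]].
have [dS|ndS] := pselect (dense (sum_mod D E) (sum_mod D' E)); last first.
  exists i, j.+1; split; [exact: chain_mono ci| |by rewrite addnS].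
  exists (sum_mod D' E); split=> //; first exact: sum_mod_submod.
  by move=> x [y [z [/D'C ? ? ->]]]; exists y, z.
(* Both steps are dense. Then s x = y + z with y in D and z in E; since z lies in D' and E, some t
   moves it into D, and t s moves x into D. *)
case: nd => x D'x.
have [s hs [y [z [Dy Ez e]]]] : exists2 s, s \notin q & sum_mod D E (s *: x).
  by apply: dS; exists x, 0; split=> //; [case: sE | rewrite addr0].
have [|t ht [Dz _]] := dI z.
  split=> //; rewrite (_ : z = s *: x - y); last by rewrite e addrAC subrr add0r.
  by apply: submodB => //; [apply: submodZ | apply: DD'].
exists (t * s); first exact: prime_notinM.
by rewrite -scalerA e scalerDr; apply: submodD => //; apply: submodZ.
Qed.

(** The modular splitting with E = B: intersecting A and C with B gives A and B, adding B gives B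
    and C. *)
Lemma chain_split k A B C : submod A -> submod B -> submod C -> A `<=` B -> B `<=` C ->
  chain k A C -> exists i j, [/\ chain i A B, chain j B C & (k <= i + j)%N].
Proof.
move=> sA sB sC AB BC ch.
have [i [j [ci cj kij]]] := chain_modular sA sC sB ch.
exists i, j; split=> //.
  by apply: chain_mono ci; [move=> x Ax; split=> //; apply: AB | move=> x []].
apply: chain_mono cj.
  by move=> x Bx; exists 0, x; split=> //; [case: sA | rewrite add0r].
by move=> x [y [z [Cy /BC Cz ->]]]; apply: submodD.
Qed.

Definition fin_len A B : Prop := exists N, forall k, chain k A B -> (k <= N)%N.

(* The length of [B / A] localised at [q]; 0 if it is infinite. *)
Definition len A B : nat :=
  xget 0%N [set n | chain n A B /\ forall k, chain k A B -> (k <= n)%N].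

Lemma lenP A B : A `<=` B -> fin_len A B ->
  chain (len A B) A B /\ forall k, chain k A B -> (k <= len A B)%N.
Proof.
move=> AB [N hN]; rewrite /len; case: xgetP => [n _ []//|] none; exfalso.
have ex : exists n, `[< chain n A B >] by exists 0%N; apply/asboolP.
have ub n : `[< chain n A B >] -> (n <= N)%N by move=> /asboolP/hN.
case: (ex_maxnP ex ub) => n /asboolP cn mx; apply: (none n); split=> // k ck.
by apply: mx; apply/asboolP.
Qed.

Lemma len_uniq A B n : chain n A B -> (forall k, chain k A B -> (k <= n)%N) -> len A B = n.
Proof.
move=> cn mx; have [cl ml] := lenP (chain_sub cn) (ex_intro (fun N => forall k, chain k A B -> (k <= N)%N) n mx).
by apply/eqP; rewrite eqn_leq mx //= ml.
Qed.

Section Additive.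
Variables A B C : M -> Prop.
Hypotheses (sA : submod A) (sB : submod B) (sC : submod C) (AB : A `<=` B) (BC : B `<=` C).

Lemma fin_lenD : fin_len A C <-> fin_len A B /\ fin_len B C.
Proof.
split=> [[N hN]|[[m hm] [n hn]]].
  split; exists N => k ck; apply: hN; first by rewrite -[k]addn0; apply: (@chain_cat k 0 A B C ck BC).
  by rewrite -[k]add0n; apply: (@chain_cat 0 k A B C AB ck).
exists (m + n)%N => k /(chain_split sA sB sC AB BC)[i [j [/hm im /hn jn /leq_trans-> //]]].
exact: leq_add.
Qed.

Lemma lenD : fin_len A C -> len A C = (len A B + len B C)%N.
Proof.
move=> /fin_lenD[fAB fBC].
have [c1 m1] := lenP AB fAB; have [c2 m2] := lenP BC fBC.
apply: len_uniq; first exact: chain_cat c2.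
move=> k /(chain_split sA sB sC AB BC)[i [j [/m1 im /m2 jn /leq_trans-> //]]].
exact: leq_add.
Qed.
End Additive.

Lemma dense_len A B : A `<=` B -> dense A B -> fin_len A B /\ len A B = 0%N.
Proof.
move=> AB d.
have h k : chain k A B -> (k <= 0)%N.
  case: k => //= k [C [_ _ CB nd _]]; exfalso; apply: nd => x /CB; exact: d.
by split; [exists 0%N | apply: len_uniq].
Qed.

Lemma len_dense A B : submod B -> A `<=` B -> fin_len A B -> len A B = 0%N -> dense A B.
Proof.
move=> sB AB fAB l0; have [_ mx] := lenP AB fAB; apply: contrapT => nd.
have /mx : chain 1 A B by exists B; split.
by rewrite l0.
Qed.
End OneModule.

Section Transfer.
Variables (M N : lmodType R) (f : {linear M -> N}) (B : M -> Prop) (B' : N -> Prop).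
Hypotheses (sB : submod B) (sB' : submod B') (fB : forall x, B x -> B' (f x)).

(** Says, without forming quotients, that f induces an isomorphism B / A -> B' / A': the second
    clause is surjectivity, the third well-definedness and injectivity. *)
Definition transfers (A : M -> Prop) (A' : N -> Prop) : Prop :=
  [/\ submod A, submod A', A `<=` B & A' `<=` B'] /\
  (forall y, B' y -> exists2 x, B x & A' (y - f x)) /\
  (forall x, B x -> (A x <-> A' (f x))).

(** Intermediate submodules correspond: C goes to f(C) + A', and C' to its preimage in B. Both
    passages preserve failure of density. *)
Lemma chain_transfer k A A' : transfers A A' -> chain k A B <-> chain k A' B'.
Proof.
elim: k A A' => [|k IH] A A' [[sA sA' AB AB'] [surj eqv]] //=.
split=> [[C [sC AC CB nd ch]] | [C' [sC' AC' CB' nd ch]]].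
  pose C' y := exists c, C c /\ A' (y - f c).
  have C'B' : C' `<=` B'.
    move=> y [c [Cc h]]; rewrite -(subrK (f c) y); apply: (submodD sB').
      exact: AB'.
    by apply: fB; apply: CB.
  have A'C' : A' `<=` C'.
    by move=> y A'y; exists 0; split; [case: sC | rewrite linear0 subr0].
  have sC' : submod C'.
    split; first by apply: A'C'; case: sA'.
    move=> a x y [c [Cc hx]] [d [Cd hy]]; exists (a *: c + d); split; first exact: sC.2.
    rewrite linearP opprD addrACA -scalerBr; exact: sA'.2.
  exists C'; split=> //.
    move=> d; apply: nd => x Cx; have [|s hs h] := d (f x).
      by exists x; split=> //; rewrite subrr; case: sA'.
    exists s => //; apply/eqv; first by apply: submodZ => //; apply: CB.
    by rewrite linearZ.
  rewrite -(IH C) //; split; first by split.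
  split=> [y /surj[x Bx h]|x Bx]; first by exists x => //; apply: A'C'.
  split=> [Cx|[c [Cc h]]]; first by exists x; split=> //; rewrite subrr; case: sA'.
  rewrite -(subrK c x); apply: submodD => //; apply: AC; apply/eqv.
    by apply: submodB => //; apply: CB.
  by rewrite linearB.
pose C x := B x /\ C' (f x).
have sC : submod C.
  split; first by split; [case: sB | rewrite linear0; case: sC'].
  by move=> a x y [Bx Cx] [By Cy]; split; [apply: sB.2 | rewrite linearP; apply: sC'.2].
have AC : A `<=` C by move=> x Ax; split; [exact: AB | apply: AC'; apply/eqv => //; exact: AB].
exists C; split=> //; first by move=> x [].
  move=> d; apply: nd => y C'y; have [x Bx h] := surj _ (CB' _ C'y).
  have [|s hs As] := d x.
    split=> //; rewrite -[f x](subKr y); apply: submodB => //; exact: AC'.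
  exists s => //; rewrite -(subrK (f x) y) scalerDr; apply: submodD => //.
    exact: submodZ.
  by rewrite -linearZ; apply/eqv => //; apply: submodZ.
rewrite (IH _ C') //; split; first by split=> // x [].
split=> [y /surj[x Bx h]|x Bx]; first by exists x => //; apply: AC'.
by split=> [[]|].
Qed.

Lemma len_transfer A A' : transfers A A' ->
  (fin_len A B <-> fin_len A' B') /\ len A B = len A' B'.
Proof.
move=> t; have e k := chain_transfer k t; split.
  by split=> -[n hn]; exists n => k /e/hn.
rewrite /len; congr xget; apply/funext => n; apply/propext.
by split=> -[c m]; split; [exact/e | move=> k /e/m | exact/e | move=> k /e/m].
Qed.
End Transfer.

(* Over the domain R / q every nonzero submodule of R / q is dense. *)
Lemma len_prime : let A : R^o -> Prop := fun x => x \in q in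
  fin_len A [set: R^o] /\ len A [set: R^o] = 1%N.
Proof.
move=> A; have sT : submod [set: R^o] by split.
have AT : A `<=` [set: R^o] by [].
have c1 : chain 1 A [set: R^o].
  exists [set: R^o]; split=> // d; have [//|s hs] := d 1.
  by rewrite /A /GRing.scale /= mulr1 => h; rewrite h in hs.
have mx k : chain k A [set: R^o] -> (k <= 1)%N.
  case: k => [|[|k]] // [C [sC AC _ nd [D [_ CD _ nd' _]]]]; exfalso; apply: nd' => y _.
  have [x Cx hx] : exists2 x, C x & x \notin q.
    apply: contrapT => h; apply: nd => x Cx; exists 1; first exact: prime_notin1.
    by rewrite scale1r; apply: contrapT => /negP ?; apply: h; exists x.
  exists x => //; rewrite (_ : x *: y = y *: (x : R^o)); last by rewrite /GRing.scale /= mulrC.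
  exact: submodZ.
by split; [exists 1%N | apply: len_uniq].
Qed.
End Length.
Arguments len_transfer {R} q {M N f B B'} sB sB' fB {A A'}.

(** * Lengths of cohomology *)

Section Homology.
Variables (R : idomainType) (q : spec R).
Implicit Types X Y : perfect R.

Definition cycles X n : X (succz n) -> Prop := fun x => diff X (succz n) x = 0.
Definition boundaries X n : X (succz n) -> Prop := fun x => exists y, diff X n y = x.

Lemma cycles_submod X n : submod (@cycles X n).
Proof.
split; first exact: linear0.
by move=> a x y; rewrite /cycles linearP => -> ->; rewrite scaler0 addr0.
Qed.

Lemma boundaries_submod X n : submod (@boundaries X n).
Proof.
split; first by exists 0; apply: linear0.
by move=> a _ _ [x <-] [y <-]; exists (a *: x + y); apply: linearP.
Qed.

Lemma boundaries_cycles X n : @boundaries X n `<=` @cycles X n.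
Proof. by move=> _ [y <-]; apply: diff_diff. Qed.

(* The cohomology in degree n + 1. *)
Definition hom_fin X n : Prop := fin_len q (@boundaries X n) (@cycles X n).
Definition hom_len X n : nat := len q (@boundaries X n) (@cycles X n).

(** Clearing denominators: if m / s is a local cycle, then u m is a cycle for some u outside q. If t
    u m = d y with t outside q, then m / s is the boundary of y / (t u s). *)
Lemma supp_dense X :
  (~ supp X q) <-> forall n, dense q (@boundaries X n) (@cycles X n).
Proof.
rewrite /supp /=; split=> [/contrapT ac n x dx|d ac].
  have [|y] := ac n (Defs.frac (x, denom1 q)).
    by rewrite /= loc_map_frac dx; apply: loc_eq1; rewrite /= scaler0.
  elim/loc_ind: y => m s; rewrite /= loc_map_frac => /frac_eq[u /= e].
  exists (sval u * sval s); first exact: denomM_subproof.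
  by exists (sval u *: m); rewrite linearZ -scalerA -e scale1r.
apply: ac => n y; elim/loc_ind: y => m s; rewrite /= loc_map_frac => /frac_eq[u /= e].
have [|t ht [y dy]] := d n (sval u *: m).
  by rewrite /cycles linearZ; move: e; rewrite scale1r scaler0 scaler0.
exists (Defs.frac (y, denomM (denomM (exist _ t ht) u) s)).
rewrite loc_map_frac; apply: loc_eq1; rewrite /= dy !scalerA.
by congr (_ *: _); ring.
Qed.

Lemma supp_hom X :
  (~ supp X q) <-> forall n, hom_fin X n /\ hom_len X n = 0%N.
Proof.
rewrite supp_dense; split=> h n.
  by apply: dense_len; [exact: boundaries_cycles | exact: h].
have [f l] := h n; apply: len_dense f l; [exact: cycles_submod | exact: boundaries_cycles].
Qed.

Lemma zero_module_len (M : lmodType R) (A B : M -> Prop) : submod A -> A `<=` B ->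
  (forall x : M, x = 0) -> fin_len q A B /\ len q A B = 0%N.
Proof.
move=> [A0 _] AB M0; apply: dense_len => // x _; exists 1; first exact: prime_notin1.
by rewrite (M0 x) scaler0.
Qed.

Lemma hom_bounded X : exists N : nat, forall n : int, (N < `|n|)%N ->
  hom_fin X n /\ hom_len X n = 0%N.
Proof.
have [N hN] := bounded X; exists N.+1 => n hn.
apply: zero_module_len; [exact: boundaries_submod | exact: boundaries_cycles |].
by apply: hN; rewrite /succz; lia.
Qed.

Lemma hom_equivalence X Y n : isomorphic X Y ->
  (hom_fin X n <-> hom_fin Y n) /\ hom_len X n = hom_len Y n.
Proof.
move=> [f [g [[h hP] [k kP]]]]; have fc x : @cycles X n x -> cycles (f _ x).
  by rewrite /cycles -chain_comm => ->; rewrite linear0.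
apply: (len_transfer q (@cycles_submod X n) (@cycles_submod Y n) fc).
split; first split; try exact: boundaries_submod; try exact: boundaries_cycles.
split=> [y dy|x dx].
  exists (g _ y); first by rewrite /cycles -chain_comm dy linear0.
  have := kP n y; rewrite /= dy linear0 addr0 => e.
  by exists (- k n y); rewrite linearN -e opprB.
split=> [[z <-]|[y dy]]; first by exists (f n z); rewrite chain_comm.
have := hP n x; rewrite /= dx linear0 addr0 -dy chain_comm => e.
by exists (g n y - h n x); rewrite linearB -e opprB addrC subrK.
Qed.

(** * The long exact sequence of a cone *)

Section LongExactSequence.
Variables (X Y : perfect R) (u : chain_map X Y).

(** These three predicates are the preimages, among cycles, of the image of H(X) in H(Y), of the
    kernel of H(X) -> H(Y), and of the image of H(Y) in H(cone u). *)
Definition from_X n (y : Y (succz n)) := exists2 x, @cycles X n x & boundaries (y - u _ x).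
Definition to_Y0 n (x : X (succz n)) := cycles x /\ boundaries (u _ x).
Definition from_Y n (v : cone u (succz n)) :=
  exists2 y, @cycles Y n y & boundaries (v - cone_in u _ y).

Lemma from_X_submod n : submod (@from_X n).
Proof.
split; first by exists 0; [exact: (cycles_submod _ _).1 | rewrite linear0 subrr; exact: (boundaries_submod _ _).1].
move=> a y y' [x cx bx] [x' cx' bx']; exists (a *: x + x'); first exact: (cycles_submod _ _).2.
rewrite linearP opprD addrACA -scalerBr; exact: (boundaries_submod _ _).2.
Qed.

Lemma from_Y_submod n : submod (@from_Y n).
Proof.
split.
  by exists 0; [exact: (cycles_submod _ _).1 | rewrite (linear0 (cone_in u (succz n))) subrr; exact: (boundaries_submod _ _).1].
move=> a y y' [x cx bx] [x' cx' bx']; exists (a *: x + x'); first exact: (cycles_submod _ _).2.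
rewrite (linearP (cone_in u (succz n))) opprD addrACA -scalerBr; exact: (boundaries_submod _ _).2.
Qed.

Lemma to_Y0_submod n : submod (@to_Y0 n).
Proof.
split.
  by split; [exact: (cycles_submod _ _).1 | rewrite linear0; exact: (boundaries_submod _ _).1].
move=> a x x' [cx bx] [cx' bx']; split; first exact: (cycles_submod _ _).2.
rewrite linearP; exact: (boundaries_submod _ _).2.
Qed.

Lemma boundaries_from_X n : @boundaries Y n `<=` @from_X n.
Proof. by move=> y by_; exists 0; [exact: (cycles_submod _ _).1 | rewrite linear0 subr0]. Qed.

Lemma from_X_cycles n : @from_X n `<=` @cycles Y n.
Proof.
move=> y [x cx /boundaries_cycles]; rewrite /cycles linearB -chain_comm cx.
by rewrite linear0 subr0.
Qed.

Lemma boundaries_from_Y n : @boundaries (cone u) n `<=` @from_Y n.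
Proof. by move=> y by_; exists 0; [exact: (cycles_submod _ _).1 | rewrite (linear0 (cone_in u (succz n))) subr0]. Qed.

Lemma from_Y_cycles n : @from_Y n `<=` @cycles (cone u) n.
Proof.
move=> y [x cx /boundaries_cycles]; rewrite /cycles linearB -chain_comm cx.
by rewrite (linear0 (cone_in u (succz (succz n)))) subr0.
Qed.

Lemma boundaries_to_Y0 n : @boundaries X n `<=` @to_Y0 n.
Proof.
move=> x bx; split; first exact: boundaries_cycles.
by have [z <-] := bx; exists (u n z); rewrite chain_comm.
Qed.

Lemma to_Y0_cycles n : @to_Y0 n `<=` @cycles X n.
Proof. by move=> x []. Qed.

Lemma transfer_XY n : transfers (u (succz n)) (@cycles X n) (@from_X n) (@to_Y0 n) (@boundaries Y n).
Proof.
split.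
  split; [exact: to_Y0_submod | exact: boundaries_submod | exact: to_Y0_cycles |].
  exact: boundaries_from_X.
split=> [y [x cx bx]|x cx]; first by exists x.
by split=> [[]|].
Qed.

(** Exactness at H(Y): a cycle of Y bounds in the cone exactly when it comes from H(X). *)
Lemma transfer_YC n :
  transfers (cone_in u (succz n)) (@cycles Y n) (@from_Y n) (@from_X n) (@boundaries (cone u) n).
Proof.
split.
  split; [exact: from_X_submod | exact: boundaries_submod | exact: from_X_cycles |].
  exact: boundaries_from_Y.
split=> [v [y cy bv]|y cy]; first by exists y.
split=> [[x cx [z dz]]|[[x z] /= [dx dz]]].
  exists ((x, z) : cone u n); rewrite /= /cone_diff /= cx oppr0 dz.
  by rewrite addrC subrK.
have dx0 : diff X (succz n) x = 0 by rewrite -[LHS]opprK dx oppr0.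
by exists x => //; exists z; rewrite -dz addrAC subrr add0r.
Qed.

(** Exactness at H(cone u) and at H(suspension X) together: the image of the connecting map is the
    kernel of H(X) -> H(Y), one degree up. *)
Lemma transfer_CX n : transfers (cone_out u (succz n)) (@cycles (cone u) n)
  (@to_Y0 (succz n)) (@from_Y n) (@boundaries X (succz n)).
Proof.
split.
  split; [exact: from_Y_submod | exact: boundaries_submod | exact: from_Y_cycles |].
  exact: boundaries_to_Y0.
split=> [x [cx [y dy]]|[x y] c].
  exists ((x, - y) : cone u (succz n)) => /=; last by rewrite subrr; exact: (boundaries_submod _ _).1.
  by rewrite /cycles /= /cone_diff /= cx oppr0 linearN dy subrr.
have [cx cy] : - diff X _ x = 0 /\ u _ x + diff Y _ y = 0 by move: c => [].
split=> [[y' _ [[x' y''] [e _]]]|[x' /= dx']].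
  by exists (- x'); rewrite linearN e /= subr0.
(* Subtracting the boundary (d x', - u x') of (- x', 0) from (x, y) leaves (0, y + u x'). *)
exists (y + u _ x'); first by rewrite /cycles linearD -chain_comm dx' addrC.
exists ((- x', 0) : cone u n); rewrite /= /cone_diff /= linearN opprK dx' linearN linear0 addr0.
by apply/pair_equal_spec; rewrite /= subr0 opprD addrA subrr add0r.
Qed.

(* Lengths of the images of the maps H(X) -> H(Y) -> H(cone u) -> H(suspension X), with
   H(Y) and H(cone u) taken in degree n + 1. *)
Definition alpha n := len q (@boundaries Y n) (@from_X n).
Definition beta n := len q (@from_X n) (@cycles Y n).
Definition gamma n := len q (@from_Y n) (@cycles (cone u) n).
Definition alpha_fin n := fin_len q (@boundaries Y n) (@from_X n).
Definition beta_fin n := fin_len q (@from_X n) (@cycles Y n).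
Definition gamma_fin n := fin_len q (@from_Y n) (@cycles (cone u) n).

Lemma hom_target n : (hom_fin Y n <-> alpha_fin n /\ beta_fin n) /\
  (hom_fin Y n -> hom_len Y n = (alpha n + beta n)%N).
Proof.
have [sB sF sC] := And3 (@boundaries_submod Y n) (@from_X_submod n) (@cycles_submod Y n).
have [i j] := (@boundaries_from_X n, @from_X_cycles n).
by split; [exact: fin_lenD | exact: lenD].
Qed.

Lemma hom_cone n : (hom_fin (cone u) n <-> beta_fin n /\ gamma_fin n) /\
  (hom_fin (cone u) n -> hom_len (cone u) n = (beta n + gamma n)%N).
Proof.
have cu y : @cycles Y n y -> from_Y (cone_in u _ y).
  by move=> cy; exists y => //; rewrite subrr; exact: (boundaries_submod _ _).1.
have [ef el] := len_transfer q (@cycles_submod Y n) (@from_Y_submod n) cu (@transfer_YC n).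
rewrite /beta_fin /beta ef el.
have [sB sF sC] := And3 (@boundaries_submod (cone u) n) (@from_Y_submod n) (@cycles_submod (cone u) n).
have [i j] := (@boundaries_from_Y n, @from_Y_cycles n).
by split; [exact: fin_lenD | exact: lenD].
Qed.

Lemma hom_source n : (hom_fin X (succz n) <-> gamma_fin n /\ alpha_fin (succz n)) /\
  (hom_fin X (succz n) -> hom_len X (succz n) = (gamma n + alpha (succz n))%N).
Proof.
have cC v : @cycles (cone u) n v -> @to_Y0 (succz n) (cone_out u _ v).
  move: v => [x y] [cx cy]; have dx : diff X _ x = 0 by rewrite -[LHS]opprK cx oppr0.
  by split=> //; exists (- y); rewrite linearN; apply/eqP; rewrite eq_sym -addr_eq0 cy.
have [gf gl] := len_transfer q (@cycles_submod (cone u) n) (@to_Y0_submod _) cC (@transfer_CX n).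
have cX x : @cycles X (succz n) x -> from_X (u _ x).
  by move=> cx; exists x => //; rewrite subrr; exact: (boundaries_submod _ _).1.
have [af al] := len_transfer q (@cycles_submod X _) (@from_X_submod _) cX (@transfer_XY _).
rewrite /gamma_fin /gamma /alpha_fin /alpha gf gl -af -al.
have [sB sF sC] := And3 (@boundaries_submod X (succz n)) (@to_Y0_submod (succz n)) (@cycles_submod X (succz n)).
have [i j] := (@boundaries_to_Y0 (succz n), @to_Y0_cycles (succz n)).
by split; [exact: fin_lenD | exact: lenD].
Qed.
End LongExactSequence.
End Homology.

(** * Euler characteristics and thick subcategories *)

Lemma succz_surj (n : int) : exists m, n = succz m.
Proof. by exists (n - 1); rewrite /succz subrK. Qed.

(** Runs over -N <= n < N. A finite window replaces the sum over all integers, and shifting the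
    index changes two end terms only. *)
Definition window_sum (N : nat) (f : int -> int) : int :=
  \sum_(0 <= i < N.*2) f (i%:Z - N%:Z).

Lemma window_sumS N f : f N%:Z = 0 -> f (- (N.+1)%:Z) = 0 ->
  window_sum N.+1 f = window_sum N f.
Proof.
move=> fN fN'; rewrite /window_sum doubleS big_nat_recl // big_nat_recr //=.
rewrite sub0r fN' add0r (_ : (N.*2.+1)%:Z - (N.+1)%:Z = N%:Z); last by lia.
by rewrite fN addr0; apply: eq_bigr => i _; congr f; lia.
Qed.

Lemma window_sum_stable N M f : (N <= M)%N -> (forall n : int, (N <= `|n|)%N -> f n = 0) ->
  window_sum M f = window_sum N f.
Proof.
move=> NM f0; elim: M NM => [|M IH]; first by rewrite leqn0 => /eqP->.
rewrite leq_eqVlt => /orP[/eqP-> //|NM]; rewrite -IH //.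
by apply: window_sumS; apply: f0; lia.
Qed.

Lemma window_sum_shift N f :
  window_sum N (fun n => f (succz n)) = window_sum N f + f N%:Z - f (- N%:Z).
Proof.
rewrite /window_sum -addrA; apply/eqP; rewrite addrC -subr_eq; apply/eqP.
rewrite -sumrB.
rewrite -(_ : \sum_(0 <= i < N.*2) (f (i.+1%:Z - N%:Z) - f (i%:Z - N%:Z)) = f N%:Z - f (- N%:Z)).
  by apply: eq_bigr => i _; congr (f _ - _); rewrite /succz; lia.
rewrite (telescope_sumr (fun i : nat => f (i%:Z - N%:Z))) // sub0r; congr (f _ - _); lia.
Qed.

Definition alt_sign (n : int) : int := (-1) ^+ `|n|%N.

Lemma alt_signS n : alt_sign (succz n) = - alt_sign n.
Proof.
rewrite /alt_sign /succz; case: n => [n|[|n]] //.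
  by rewrite -PoszD addn1 !absz_nat exprS mulN1r.
rewrite (_ : Negz n.+1 + 1 = Negz n); last by lia.
by rewrite [RHS]/= exprS mulN1r opprK.
Qed.

Section EulerCharacteristic.
Variables (R : idomainType) (q : spec R).
Implicit Types X Y : perfect R.

Definition euler_sum X N := window_sum N (fun n => alt_sign (succz n) * (hom_len q X n)%:Z).

(** The eventual value of the truncated sums, hence independent of any chosen bound for X. Index n
    stands for degree n + 1, which explains the sign in [euler_sum]. *)
Definition chi X : int := xget 0 [set c | exists N0, forall N, (N0 <= N)%N -> euler_sum X N = c].

Lemma chiP X : exists N0, forall N, (N0 <= N)%N -> euler_sum X N = chi X.
Proof.
rewrite /chi; case: xgetP => [c _ //|none]; exfalso.
have [N hN] := hom_bounded q X; apply: (none (euler_sum X N.+1)); exists N.+1 => M NM.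
by apply: window_sum_stable => // n hn; have [_ ->] := hN n hn; rewrite mulr0.
Qed.

Lemma chi_iso X Y : isomorphic X Y -> chi X = chi Y.
Proof.
move=> XY; rewrite /chi; congr xget; apply/funext => c.
suff e N : euler_sum X N = euler_sum Y N.
  by apply/propext; split=> -[N0 h]; exists N0 => N /h <-; rewrite e.
by apply: eq_bigr => i _; have [_ ->] := hom_equivalence q (i%:Z - N%:Z) XY.
Qed.

(** The lengths for Y, the cone and the suspension of X are alpha + beta, beta + gamma and gamma +
    alpha one degree up. The gammas cancel by sign. The alphas agree after a shift of the window,
    whose end terms vanish for large N. *)
Lemma chi_cone X Y (u : chain_map X Y) : (forall n, hom_fin q X n) -> (forall n, hom_fin q Y n) ->
  (forall n, hom_fin q (cone u) n) -> chi Y = chi X + chi (cone u).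
Proof.
move=> fX fY fC.
have [N1 e1] := chiP X; have [N2 e2] := chiP Y; have [N3 e3] := chiP (cone u).
have [N4 b1] := hom_bounded q X; have [N5 b2] := hom_bounded q Y.
pose N := (N1 + N2 + N3 + N4 + N5 + 2)%N.
rewrite -(e1 N) -?(e2 N) -?(e3 N) /euler_sum; try lia.
pose x n := alt_sign (succz n) * (hom_len q X n)%:Z.
have ex n : (N4 < `|n|)%N -> x n = 0 by move=> hn; have [_ z] := b1 n hn; rewrite /x z mulr0.
have := window_sum_shift N x; rewrite !ex; try lia.
rewrite addr0 subr0 => <-.
pose a n := alt_sign (succz n) * (alpha q u n)%:Z.
have ea n : (N5 < `|n|)%N -> a n = 0.
  move=> hn; have [_ z'] := b2 n hn; have [_ h] := hom_target q u n.
  by rewrite /a; move: (h (fY n)); rewrite z' => /esym/eqP; rewrite addn_eq0 => /andP[/eqP-> _]; rewrite mulr0.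
have := window_sum_shift N a; rewrite !ea; try lia.
rewrite addr0 subr0 /window_sum => e.
transitivity (\sum_(0 <= i < N.*2) a (i%:Z - N%:Z)
   + \sum_(0 <= i < N.*2) alt_sign (succz (i%:Z - N%:Z)) * (beta q u (i%:Z - N%:Z))%:Z).
  rewrite -big_split; apply: eq_bigr => i _ /=.
  by have [_ ->] := hom_target q u (i%:Z - N%:Z); rewrite // PoszD mulrDr.
rewrite -e -!big_split; apply: eq_bigr => i _ /=; rewrite /x.
have [_ ->] := hom_source q u (i%:Z - N%:Z); rewrite //.
have [_ ->] := hom_cone q u (i%:Z - N%:Z); rewrite // !PoszD /a !alt_signS; ring.
Qed.
End EulerCharacteristic.

(** * Classes of complexes closed under cones *)

Section Thick.
Variable R : idomainType.
Implicit Types (X Y Z A B C : perfect R).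

Definition null X : Prop := forall n (x : X n), x = 0.

(** Two out of three on cones, as for a triangulated subcategory. Closure under direct summands is
    not imposed: [in_K0 H] contains the sum of X and its suspension for every X supported on S, so
    it fails this closure when H is a proper subgroup. *)
Definition thick (P : perfect R -> Prop) : Prop :=
  [/\ forall X Y, isomorphic X Y -> P X -> P Y,
      forall X, null X -> P X
    & forall X Y (u : chain_map X Y),
      [/\ P X -> P Y -> P (cone u), P X -> P (cone u) -> P Y & P Y -> P (cone u) -> P X]].

Lemma thick_hom_fin q : thick (fun X => forall n, hom_fin q X n).
Proof.
split=> [X Y XY h n|X X0 n|X Y u].
- by have [<- _] := hom_equivalence q n XY.
- have [] // := zero_module_len q (@boundaries_submod R X n) (@boundaries_cycles R X n).
have t n := (hom_target q u n).1; have c n := (hom_cone q u n).1; have s n := (hom_source q u n).1.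
split=> h k n.
- by apply/c; split; [have /t[] := k n | have /s[] := h (succz n)].
- have [m ->] := succz_surj n; apply/t.
  by split; [have /s[] := h (succz m) | have /c[] := k (succz m)].
- have [m ->] := succz_surj n; apply/s.
  by split; [have /c[] := k m | have /t[] := h (succz m)].
Qed.

Lemma thick_nsupp q : thick (fun X => ~ supp X q).
Proof.
have [fi fn fc] := thick_hom_fin q.
split=> [X Y XY|X X0|X Y u].
- move=> /supp_hom h; apply/supp_hom => n; have [h1 h2] := h n.
  by have [<- <-] := hom_equivalence q n XY.
- apply/supp_hom => n.
  apply: zero_module_len; [exact: boundaries_submod | exact: boundaries_cycles | exact: X0].
have [f1 f2 f3] := fc X Y u.
have t n := (hom_target q u n).2; have c n := (hom_cone q u n).2; have s n := (hom_source q u n).2.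
split=> /supp_hom h /supp_hom k; apply/supp_hom.
- have f n : hom_fin q (cone u) n by apply: f1 => m; [case: (h m) | case: (k m)].
  move=> n; split=> //; rewrite c //.
  have [a1 a2] := h (succz n); have [b1 b2] := k n.
  by move: (s n a1) (t n b1); rewrite a2 b2; lia.
- have f n : hom_fin q Y n by apply: f2 => m; [case: (h m) | case: (k m)].
  move=> n; split=> //; rewrite t //; have [m e] := succz_surj n; rewrite e.
  have [a1 a2] := h (succz m); have [b1 b2] := k (succz m).
  by move: (s m a1) (c _ b1); rewrite a2 b2; lia.
- have f n : hom_fin q X n by apply: f3 => m; [case: (h m) | case: (k m)].
  move=> n; have [m e] := succz_surj n; rewrite e; split=> //; rewrite s //.
  have [a1 a2] := h (succz m); have [b1 b2] := k m.
  by move: (t _ a1) (c m b1); rewrite a2 b2; lia.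
Qed.

Lemma thick_supp (S : set (spec R)) : thick (fun X => supp X `<=` S).
Proof.
split=> [X Y XY h|X X0|X Y u].
- move=> q; apply: contraPP => nS; have [iso _ _] := thick_nsupp q.
  by apply: iso XY _ => /h.
- by move=> q; apply: contraPP => nS; have [_ nul _] := thick_nsupp q; apply: nul.
have c q : ~ S q -> _ := fun _ => let: And3 _ _ c := thick_nsupp q in c X Y u.
by split=> h k q; apply: contraPP => nS; have [c1 c2 c3] := c q nS; auto.
Qed.

Lemma homotopic_ext X Y (f g : chain_map X Y) : (forall n x, f n x = g n x) -> homotopic f g.
Proof. by move=> e; exists (fun n => \0) => n x; rewrite e subrr /= linear0 addr0. Qed.

Definition strict_iso X Y : Prop := exists (f : chain_map X Y) (g : chain_map Y X),
  (forall n x, g n (f n x) = x) /\ (forall n y, f n (g n y) = y).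

Lemma strict_isomorphic X Y : strict_iso X Y -> isomorphic X Y.
Proof. by move=> [f [g [gf fg]]]; exists f, g; split; apply: homotopic_ext. Qed.

Lemma zero_complex_bounded : exists N : nat, forall n : int, (N < `|n|)%N ->
  forall x : zero_module R, x = 0.
Proof. by exists 0%N => n _ x; apply/rowP => -[]. Qed.

Lemma zero_complex_diff (n : int) (x : zero_module R) :
  (\0 : {linear zero_module R -> zero_module R}) ((\0 : {linear zero_module R -> zero_module R}) x) = 0.
Proof. by []. Qed.

Definition zero_complex : perfect R :=
  @Perfect R (fun=> zero_module R) (fun=> \0) zero_complex_diff zero_complex_bounded.

Lemma zero_complex_null : null zero_complex.
Proof. by move=> n x; apply/rowP => -[]. Qed.

Lemma zero_map_comm X Y n (x : X n) :
  (\0 : {linear X (succz n) -> Y (succz n)}) (diff X n x) = diff Y n ((\0 : {linear X n -> Y n}) x).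
Proof. by rewrite /= linear0. Qed.

Definition zero_map X Y : chain_map X Y := ChainMap (@zero_map_comm X Y).

Definition contractible X : Prop := homotopic (chain_id X) (zero_map X X).

Lemma null_contractible X : null X -> contractible X.
Proof. by move=> X0; apply: homotopic_ext => n x; rewrite [LHS]X0 [RHS]X0. Qed.

Lemma contractible_isomorphic X Y : contractible X -> contractible Y -> isomorphic X Y.
Proof.
move=> cX cY; exists (zero_map X Y), (zero_map Y X).
by split; apply: homotopic_trans (homotopic_sym _); try exact: cX; try exact: cY;
  apply: homotopic_ext.
Qed.

Lemma thick_contractible P X : thick P -> contractible X -> P X.
Proof.
move=> [iso nul _] cX; apply: iso (nul _ zero_complex_null).
by apply: contractible_isomorphic => //; apply: null_contractible; apply: zero_complex_null.
Qed.

Lemma cone_zero_suspension X : strict_iso (cone (zero_map X zero_complex)) (suspension X).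
Proof.
have lin n : linear (fun x : X (succz n) => (x, 0) : cone (zero_map X zero_complex) n).
  by move=> c x y; rewrite pair_linE scaler0 addr0.
have cm n (x : X (succz n)) :
  (mk_linear (lin (succz n)) (diff (suspension X) n x)) = diff (cone (zero_map X zero_complex)) n (mk_linear (lin n) x).
  by apply/pair_equal_spec; rewrite /= addr0.
exists (cone_out (zero_map X zero_complex)), (@ChainMap R (suspension X) _ (fun n => mk_linear (lin n)) cm).
split=> // n [x y] /=; apply/pair_equal_spec; split=> //.
by rewrite [RHS](@zero_complex_null n).
Qed.

Lemma thick_suspension P X : thick P -> P (suspension X) <-> P X.
Proof.
move=> [iso nul co]; have [c1 c2 c3] := co _ _ (zero_map X zero_complex).
have z := nul _ zero_complex_null; have e := strict_isomorphic (cone_zero_suspension X).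
split=> h; first by apply: c3 => //; apply: iso h; apply: isomorphic_sym.
by apply: iso e _; apply: c1.
Qed.
End Thick.

(** * Classes of cones in K_0 *)

Section K0Cone.
Variables (R : idomainType) (S : set (spec R)).
Implicit Types X Y : perfect R.

Lemma cone_exact_triangle X Y (u : chain_map X Y) : exact_triangle u (cone_in u) (cone_out u).
Proof.
exists X, Y, u, (chain_id X), (chain_id Y), (chain_id (cone u)).
by split; split; try exact: homotopy_equivalence_id; apply: homotopic_ext.
Qed.

Lemma K0_cone X Y (u : chain_map X Y)
    (hX : supp X `<=` S) (hY : supp Y `<=` S) (hC : supp (cone u) `<=` S) :
  K0_class (supported hY) = K0_class (supported hX) +g K0_class (supported hC).
Proof. exact: (@K0_triangle _ _ (supported hX) (supported hY) (supported hC) _ _ _ (cone_exact_triangle u)). Qed.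

(** X is isomorphic to the cone of its own identity, so [X] = [X] + [X]. *)
Lemma K0_null X (hX : supp X `<=` S) : null X -> K0_class (supported hX) = ab_zero _.
Proof.
move=> X0; have nc : null (cone (chain_id X)).
  by move=> n [x y]; rewrite (X0 _ x) (X0 _ y).
have [_ nul _] := @thick_supp R S; have hC := nul _ nc.
apply: (@ab_addI _ (K0_class (supported hX))); rewrite ab_add0r.
rewrite [RHS](K0_cone (u := chain_id X) hX hX hC); congr ab_add; apply: K0_class_iso.
by apply: contractible_isomorphic; apply: null_contractible.
Qed.

Definition in_K0 (H : K0 S -> Prop) X : Prop :=
  exists hX : supp X `<=` S, H (K0_class (supported hX)).

(** Turns generation of K_0 into a devissage: if every supported complex satisfies [in_K0 H], then H
    is all of K_0. *)
Lemma thick_in_K0 (H : K0 S -> Prop) : ab_subgroup H -> thick (in_K0 H).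
Proof.
move=> [H0 HD HN]; have [iso nul co] := @thick_supp R S.
split=> [X Y XY [hX HX]|X X0|X Y u].
- by exists (iso _ _ XY hX); rewrite -(@K0_class_iso _ _ (supported hX)).
- by exists (nul _ X0); rewrite K0_null.
have [c1 c2 c3] := co X Y u; split=> -[h1 H1] [h2 H2].
- exists (c1 h1 h2); rewrite (_ : K0_class _ = K0_class (supported h2) +g ab_opp (K0_class (supported h1))).
    by apply: HD => //; apply: HN.
  by rewrite (K0_cone (u := u) h1 h2 (c1 h1 h2)) ab_addC ab_addA ab_addN ab_add0.
- by exists (c2 h1 h2); rewrite (K0_cone (u := u) h1 (c2 h1 h2) h2); apply: HD.
- exists (c3 h1 h2); rewrite (_ : K0_class _ = K0_class (supported h1) +g ab_opp (K0_class (supported h2))).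
    by apply: HD => //; apply: HN.
  by rewrite (K0_cone (u := u) (c3 h1 h2) h1 h2) -ab_addA ab_addNr ab_add0r.
Qed.

Lemma chi_triangle (q : spec R) (A B C : perfect R) (f : chain_map A B) (g : chain_map B C) (h : chain_map C (suspension A)) :
  (forall n, hom_fin q A n) -> (forall n, hom_fin q B n) -> (forall n, hom_fin q C n) ->
  exact_triangle f g h -> chi q B = chi q A + chi q C.
Proof.
move=> fA fB fC [X [Y [u [a [b [c [[ea eb ec] _]]]]]]].
have [iso _ _] := thick_hom_fin q.
have [AX BY CC] : [/\ isomorphic A X, isomorphic B Y & isomorphic C (cone u)].
  by split; [exists a | exists b | exists c].
rewrite (chi_iso q AX) (chi_iso q BY) (chi_iso q CC); apply: chi_cone.
- exact: iso AX fA.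
- exact: iso BY fB.
- exact: iso CC fC.
Qed.
End K0Cone.

(** * Kernels of degreewise surjections *)

Section KernelModule.
Variables (R : idomainType) (M N : lmodType R) (f : {linear M -> N}).

Definition kernel_pred : {pred M} := fun x => f x == 0.

Lemma kernel_submod_closed : submod_closed kernel_pred.
Proof.
split; first by rewrite /in_mem /= /kernel_pred linear0.
by move=> a x y /eqP fx /eqP fy; rewrite /in_mem /= /kernel_pred linearP fx fy scaler0 addr0.
Qed.

HB.instance Definition _ :=
  GRing.isSubmodClosed.Build R M kernel_pred (GRing.submod_closed_semi kernel_submod_closed).

Record kernel := Kernel { kernel_val : M; kernel_valP : kernel_val \in kernel_pred }.

HB.instance Definition _ := [isSub of kernel for kernel_val].
HB.instance Definition _ := [Choice of kernel by <:].
HB.instance Definition _ := [SubChoice_isSubLmodule of kernel by <:].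

Lemma kernel_val_linear : linear kernel_val.
Proof. by []. Qed.

Definition kernel_incl : {linear kernel -> M} := mk_linear kernel_val_linear.

Lemma kernelP (k : kernel) : f (kernel_val k) = 0.
Proof. exact/eqP/(kernel_valP k). Qed.

Definition in_kernel x (e : f x = 0) : kernel := @Kernel x (introT eqP e).
End KernelModule.

Section Retracts.
Variable R : idomainType.

Lemma retract_fg (M K : lmodType R) (i : {linear K -> M}) (r : {linear M -> K}) :
  (forall x, r (i x) = x) -> finitely_generated M -> finitely_generated K.
Proof.
move=> ri [n [g hg]]; exists n, (fun j => r (g j)) => x.
have [c e] := hg (i x); exists c; rewrite -[LHS]ri e linear_sum.
by apply: eq_bigr => j _; rewrite linearZ.
Qed.

Lemma retract_projective (M K : lmodType R) (i : {linear K -> M}) (r : {linear M -> K}) :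
  (forall x, r (i x) = x) -> projective M -> projective K.
Proof.
move=> ri pM A B g f surj; have [h hP] := pM A B g (f \o r) surj.
by exists (h \o i) => x; rewrite /= hP /= ri.
Qed.

Lemma row_fg n : finitely_generated 'rV[R]_n.
Proof.
exists n, (fun j => delta_mx 0 j) => x; exists (fun j => x 0 j); exact: row_sum_delta.
Qed.

Lemma row_projective n : projective 'rV[R]_n.
Proof.
move=> A B g f surj.
have /choice[a ha] : forall j : 'I_n, exists a, g a = f (delta_mx 0 j) by move=> j; exact: surj.
have lin : linear (fun x : 'rV[R]_n => \sum_j x 0 j *: a j).
  move=> c x y; rewrite scaler_sumr -big_split; apply: eq_bigr => j _ /=.
  by rewrite !mxE scalerDl scalerA.
exists (mk_linear lin) => x; rewrite /= linear_sum [in RHS](row_sum_delta x) linear_sum.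
by apply: eq_bigr => j _; rewrite !linearZ /= ha.
Qed.

Definition row_module n : proj_module R := ProjModule (@row_fg n) (@row_projective n).
End Retracts.

Section Kernels.
Variables (R : idomainType) (X Q : perfect R) (p : chain_map X Q).
Hypothesis p_surj : forall n (y : Q n), exists x, p n x = y.

(** Projectivity of Q n splits p in each degree; the sections need not commute with the
    differentials. *)
Lemma section_ex n : exists s : {linear Q n -> X n}, forall y, p n (s y) = y.
Proof. by have [s sP] := @proj_proj R (Q n) _ _ (p n) idfun (@p_surj n); exists s. Qed.

Definition sect n : {linear Q n -> X n} := sval (cid (section_ex n)).

Lemma sectK n y : p n (@sect n y) = y.
Proof. by rewrite /sect; case: cid. Qed.

Lemma retraction_subproof n (x : X n) : p n (x - sect _ (p n x)) = 0.
Proof. by rewrite linearB sectK subrr. Qed.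

Definition retraction_fun n (x : X n) : kernel (p n) := in_kernel (retraction_subproof x).

Lemma retraction_linear n : linear (@retraction_fun n).
Proof. by move=> a x y; apply: val_inj; rewrite /= (linearP (p n)) (linearP (sect n)) opprD addrACA scalerBr. Qed.

Definition retraction n : {linear X n -> kernel (p n)} := mk_linear (@retraction_linear n).

Lemma retractionK n (k : kernel (p n)) : retraction n (kernel_incl (p n) k) = k.
Proof. by apply: val_inj; rewrite /= kernelP linear0 subr0. Qed.

Definition kernel_term n : proj_module R :=
  ProjModule (retract_fg (@retractionK n) (@proj_fg _ (X n)))
             (retract_projective (@retractionK n) (@proj_proj _ (X n))).

Lemma kernel_diff_subproof n (k : kernel (p n)) : p (succz n) (diff X n (kernel_val k)) = 0.
Proof. by rewrite chain_comm kernelP linear0. Qed.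

Definition kernel_diff_fun n (k : kernel_term n) : kernel_term (succz n) :=
  in_kernel (kernel_diff_subproof k).

Lemma kernel_diff_linear n : linear (@kernel_diff_fun n).
Proof. by move=> a x y; apply: val_inj; rewrite /= linearP. Qed.

Lemma kernel_diff_diff n (k : kernel_term n) :
  mk_linear (@kernel_diff_linear (succz n)) (mk_linear (@kernel_diff_linear n) k) = 0.
Proof. by apply: val_inj; rewrite /= diff_diff. Qed.

Lemma kernel_bounded : exists N : nat, forall n : int, (N < `|n|)%N ->
  forall k : kernel_term n, k = 0.
Proof. by have [N hN] := bounded X; exists N => n nN k; apply: val_inj; apply: hN. Qed.

Definition kernel_complex : perfect R :=
  @Perfect R kernel_term (fun n => mk_linear (@kernel_diff_linear n)) kernel_diff_diff kernel_bounded.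

Lemma kernel_map_comm n (k : kernel_complex n) :
  kernel_incl _ (diff kernel_complex n k) = diff X n (kernel_incl _ k).
Proof. by []. Qed.

Definition kernel_map : chain_map kernel_complex X :=
  @ChainMap R kernel_complex X (fun n => kernel_incl _) kernel_map_comm.

Lemma kernel_cone_to_linear n : linear (fun v : cone kernel_map n => p n v.2).
Proof. by move=> a [k x] [k' x']; rewrite /= linearP. Qed.

Lemma kernel_cone_to_comm n (v : cone kernel_map n) :
  mk_linear (@kernel_cone_to_linear (succz n)) (diff (cone kernel_map) n v)
  = diff Q n (mk_linear (@kernel_cone_to_linear n) v).
Proof. by case: v => k x; rewrite /= linearD kernelP add0r chain_comm. Qed.

Definition kernel_cone_to : chain_map (cone kernel_map) Q := ChainMap kernel_cone_to_comm.

Lemma kernel_cone_from_subproof n (y : Q n) : p (succz n) (sect _ (diff Q n y) - diff X n (sect _ y)) = 0.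
Proof. by rewrite linearB chain_comm !sectK subrr. Qed.

(** The first coordinate is the failure of [sect] to be a chain map, which lies in the kernel
    because p is one. *)
Definition kernel_cone_from_fun n (y : Q n) : cone kernel_map n :=
  (in_kernel (kernel_cone_from_subproof y) : kernel_complex (succz n), sect _ y).

Lemma kernel_cone_from_linear n : linear (@kernel_cone_from_fun n).
Proof.
move=> a y y'; apply/pair_equal_spec; split; last by rewrite /= linearP.
apply: val_inj; rewrite /= (linearP (sect n)) !(linearP (diff _ _)) (linearP (sect _)).
by rewrite opprD addrACA -scalerBr.
Qed.

Lemma kernel_cone_from_comm n (y : Q n) :
  mk_linear (@kernel_cone_from_linear (succz n)) (diff Q n y)
  = diff (cone kernel_map) n (mk_linear (@kernel_cone_from_linear n) y).
Proof.
apply/pair_equal_spec; split; last by rewrite /= subrK.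
apply: val_inj; rewrite /= diff_diff linear0 sub0r linearB diff_diff subr0.
by [].
Qed.

Definition kernel_cone_from : chain_map Q (cone kernel_map) := ChainMap kernel_cone_from_comm.

Lemma kernel_homotopy_linear n : linear (fun v : cone kernel_map (succz n) =>
  (retraction (succz n) v.2 : kernel_complex (succz n), 0) : cone kernel_map n).
Proof.
move=> a [k x] [k' x']; apply/pair_equal_spec; split; last by rewrite /= scaler0 addr0.
exact: (linearP (retraction (succz n))).
Qed.

(** A degreewise split short exact sequence gives a triangle. The composite through Q differs from
    the identity of the cone by the homotopy that retracts the second coordinate onto the kernel. *)
Lemma kernel_cone_isomorphic : isomorphic (cone kernel_map) Q.
Proof.
exists kernel_cone_to, kernel_cone_from; split; last first.
  by apply: homotopic_ext => n y; rewrite /= sectK.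
apply: homotopic_sym; exists (fun n => mk_linear (@kernel_homotopy_linear n)) => n [k x].
apply/pair_equal_spec; split; last by rewrite /= linear0 !addr0.
apply: val_inj; rewrite /=.
rewrite (linearD (p _)) kernelP add0r chain_comm (linearB (diff X _)) !opprB.
by rewrite [kernel_val k + _ - _]addrAC [_ + diff X _ x]addrC [RHS]addrA subrK addrCA.
Qed.
End Kernels.

(** * Octahedra, spheres and Moore complexes *)

Section Octahedron.
Variables (R : idomainType) (A B C : perfect R).
Variables (f : chain_map A B) (g : chain_map B C) (k : chain_map A C).
Hypothesis kE : forall n x, k n x = g n (f n x).

Lemma cone_map_linear n : linear (fun v : cone f n => (v.1, g n v.2) : cone k n).
Proof. by move=> c [x y] [x' y']; apply/pair_equal_spec; rewrite /= linearP. Qed.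

Lemma cone_map_comm n (v : cone f n) :
  mk_linear (@cone_map_linear (succz n)) (diff (cone f) n v)
  = diff (cone k) n (mk_linear (@cone_map_linear n) v).
Proof.
by case: v => x y; apply/pair_equal_spec; rewrite /= linearD kE chain_comm.
Qed.

Definition cone_map : chain_map (cone f) (cone k) := ChainMap cone_map_comm.

Lemma oct_to_linear n : linear (fun v : cone cone_map n =>
  (v.1.2 + f (succz n) v.2.1, v.2.2) : cone g n).
Proof.
move=> c [[a' b] [a z]] [[a1' b1] [a1 z1]]; apply/pair_equal_spec; split=> //=.
by rewrite linearP scalerDr addrACA.
Qed.

Lemma oct_to_comm n (v : cone cone_map n) :
  mk_linear (@oct_to_linear (succz n)) (diff (cone cone_map) n v)
  = diff (cone g) n (mk_linear (@oct_to_linear n) v).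
Proof.
case: v => [[a' b] [a c]]; apply/pair_equal_spec; split; rewrite /=.
  rewrite !(linearD (f _)) !(linearD (diff _ _)) !linearN /= (chain_comm f) /=.
  by rewrite opprD addrACA addNr add0r opprD.
by rewrite linearD kE addrA.
Qed.

Definition oct_to : chain_map (cone cone_map) (cone g) := ChainMap oct_to_comm.

Lemma oct_from_linear n : linear (fun v : cone g n => ((0, v.1), (0, v.2)) : cone cone_map n).
Proof.
by move=> c [x y] [x' y']; apply/pair_equal_spec; split; apply/pair_equal_spec;
  rewrite /= scaler0 addr0.
Qed.

Lemma oct_from_comm n (v : cone g n) :
  mk_linear (@oct_from_linear (succz n)) (diff (cone g) n v)
  = diff (cone cone_map) n (mk_linear (@oct_from_linear n) v).
Proof.
case: v => [b c]; apply/pair_equal_spec; split; apply/pair_equal_spec; split;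
  by rewrite /= ?linear0 ?oppr0 ?linear0 ?add0r ?addr0.
Qed.

Definition oct_from : chain_map (cone g) (cone cone_map) := ChainMap oct_from_comm.

Lemma oct_homotopy_linear n : linear (fun v : cone cone_map (succz n) =>
  ((v.2.1, 0), (0, 0)) : cone cone_map n).
Proof.
by move=> c v v'; apply/pair_equal_spec; split; apply/pair_equal_spec;
  rewrite /= ?scaler0 ?addr0.
Qed.

(** The two copies of A in the iterated cone cancel like the cone of an identity: the homotopy moves
    the copy in [cone k] to the one in [cone f]. What remains is [cone g]. *)
Lemma octahedron : isomorphic (cone cone_map) (cone g).
Proof.
exists oct_to, oct_from; split; last first.
  by apply: homotopic_ext => n [b c]; rewrite /= linear0 addr0.
apply: homotopic_sym; exists (fun n => mk_linear (@oct_homotopy_linear n)) => n [[a' b] [a c]].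
apply/pair_equal_spec; split; apply/pair_equal_spec; split; rewrite /=.
- by rewrite opprK subr0 addrCA subrr addr0.
- by rewrite linear0 addr0 opprD addrA subrr sub0r addr0.
- by rewrite (linear0 (diff _ _)) oppr0 !addr0.
- by rewrite subrr !(linear0 (g _)) !(linear0 (k _)) !(linear0 (diff _ _)) !addr0.
Qed.

Lemma thick_octahedron P : thick P -> P (cone f) -> P (cone g) -> P (cone k).
Proof.
move=> [iso _ co] Pf Pg; have [_ c _] := co _ _ cone_map; apply: c => //.
by apply: iso Pg; apply: isomorphic_sym; apply: octahedron.
Qed.
End Octahedron.

Section Spheres.
Variable R : idomainType.
Implicit Types A B X Y : perfect R.

Lemma scalar_cone_iso a A B : strict_iso A B ->
  strict_iso (cone (scalar_map a A)) (cone (scalar_map a B)).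
Proof.
suff H A' B' (f : chain_map A' B') : exists F : chain_map (cone (scalar_map a A')) (cone (scalar_map a B')),
    forall n v, F n v = (f (succz n) v.1, f n v.2).
  move=> [f [g [gf fg]]]; have [F hF] := H _ _ f; have [G hG] := H _ _ g.
  by exists F, G; split=> n [x y]; rewrite hG hF /= ?gf ?fg.
have lin n : linear (fun v : cone (scalar_map a A') n =>
    (f (succz n) v.1, f n v.2) : cone (scalar_map a B') n).
  by move=> c [x y] [x' y']; apply/pair_equal_spec; rewrite /= !linearP.
have cm n (v : cone (scalar_map a A') n) : mk_linear (lin (succz n)) (diff (cone (scalar_map a A')) n v)
    = diff (cone (scalar_map a B')) n (mk_linear (lin n) v).
  by case: v => x y; apply/pair_equal_spec; rewrite /= linearN linearD linearZ /= !chain_comm.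
by exists (ChainMap cm).
Qed.

Lemma scalar_cone_suspension a A :
  strict_iso (cone (scalar_map a (suspension A))) (suspension (cone (scalar_map a A))).
Proof.
have l1 n : linear (fun v : cone (scalar_map a (suspension A)) n =>
    (v.1, - v.2) : suspension (cone (scalar_map a A)) n).
  by move=> c [x y] [x' y']; apply/pair_equal_spec; rewrite /= opprD scalerN.
have l2 n : linear (fun v : suspension (cone (scalar_map a A)) n =>
    (v.1, - v.2) : cone (scalar_map a (suspension A)) n).
  by move=> c [x y] [x' y']; apply/pair_equal_spec; rewrite /= opprD scalerN.
have c1 n (v : cone (scalar_map a (suspension A)) n) :
    mk_linear (l1 (succz n)) (diff (cone (scalar_map a (suspension A))) n v)
    = diff (suspension (cone (scalar_map a A))) n (mk_linear (l1 n) v).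
  by case: v => x y; apply/pair_equal_spec; rewrite /= (linearN (diff _ _)).
have c2 n (v : suspension (cone (scalar_map a A)) n) :
    mk_linear (l2 (succz n)) (diff (suspension (cone (scalar_map a A))) n v)
    = diff (cone (scalar_map a (suspension A))) n (mk_linear (l2 n) v).
  by case: v => x y; apply/pair_equal_spec; rewrite /= (linearN (diff _ _)) !opprK.
by exists (ChainMap c1), (ChainMap c2); split=> n [x y] /=; rewrite opprK.
Qed.

Lemma scalar_cone_unit a A : a \is a GRing.unit -> contractible (cone (scalar_map a A)).
Proof.
move=> ua.
have l n : linear (fun v : cone (scalar_map a A) (succz n) =>
    (a^-1 *: v.2, 0) : cone (scalar_map a A) n).
  move=> c [x y] [x' y']; apply/pair_equal_spec; rewrite /= scaler0 addr0; split=> //.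
  by rewrite scalerDr !scalerA mulrC.
exists (fun n => mk_linear (l n)) => n [x y]; apply/pair_equal_spec; split; rewrite /= subr0.
  by rewrite linearZ /= scalerDr scalerA mulVr // scale1r addrCA addNr addr0.
by rewrite linear0 !addr0 scalerA divrr // scale1r.
Qed.

Lemma zero_diff_iso X Y : (forall n x, diff X n x = 0) -> (forall n y, diff Y n y = 0) ->
  (forall n, exists (f : {linear X n -> Y n}) (g : {linear Y n -> X n}),
     (forall x, g (f x) = x) /\ (forall y, f (g y) = y)) ->
  strict_iso X Y.
Proof.
move=> dX dY h; pose f n := sval (cid (h n)); pose g n := sval (cid (svalP (cid (h n)))).
have fg n : (forall x, g n (f n x) = x) /\ (forall y, f n (g n y) = y).
  by rewrite /g; case: (cid (svalP (cid (h n)))).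
have cf n (x : X n) : f (succz n) (diff X n x) = diff Y n (f n x) by rewrite dX dY linear0.
have cg n (y : Y n) : g (succz n) (diff Y n y) = diff X n (g n y) by rewrite dX dY linear0.
by exists (ChainMap cf), (ChainMap cg); split=> n; case: (fg n).
Qed.

(** The boolean is read as the rank 1 or 0, so maps into the sphere are given by [const_mx] in all
    degrees at once. *)
Definition sphere_term (n0 n : int) : proj_module R := row_module R (n == n0).

Definition sphere_diff n0 n : {linear sphere_term n0 n -> sphere_term n0 (succz n)} := \0.

Lemma sphere_diff_diff n0 n (x : sphere_term n0 n) : sphere_diff n0 (succz n) (sphere_diff n0 n x) = 0.
Proof. by []. Qed.

Lemma sphere_null (n0 n : int) : n != n0 -> forall x : sphere_term n0 n, x = 0.
Proof. by rewrite /sphere_term => /negbTE -> x; apply/rowP => -[]. Qed.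

Lemma sphere_bounded n0 : exists N : nat, forall n : int, (N < `|n|)%N ->
  forall x : sphere_term n0 n, x = 0.
Proof.
by exists `|n0|%N => n hn; apply: sphere_null; apply: contraTneq hn => ->; rewrite ltnn.
Qed.

Definition sphere n0 : perfect R :=
  @Perfect R (sphere_term n0) (sphere_diff n0) (@sphere_diff_diff n0) (sphere_bounded n0).

Lemma sphere_suspension n0 : strict_iso (sphere n0) (suspension (sphere (succz n0))).
Proof.
apply: zero_diff_iso => // [n y|n]; first by rewrite /= oppr0.
suff H (b c : bool) : b = c -> exists (f : {linear row_module R b -> row_module R c})
    (g : {linear row_module R c -> row_module R b}),
    (forall x, g (f x) = x) /\ (forall y, f (g y) = y).
  by apply: H; rewrite /succz (inj_eq (addIr 1)).
by move=> ->; exists idfun, idfun.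
Qed.

Lemma sphere_ring : strict_iso (sphere 0) (ring_complex R).
Proof.
apply: zero_diff_iso => // -[[|n]|n]; try by exists idfun, idfun.
have l1 : linear (fun x : 'rV[R]_1 => x 0 0 : R^o) by move=> c x y; rewrite !mxE.
have l2 : linear (fun x : R^o => const_mx x : 'rV[R]_1).
  by move=> c x y; apply/rowP => j; rewrite !mxE.
exists (mk_linear l1), (mk_linear l2); split=> [x|x] /=; last by rewrite mxE.
by apply/rowP => j; rewrite mxE !ord1.
Qed.

Lemma thick_shifts P (F : int -> perfect R) : thick P ->
  (forall n, strict_iso (F n) (suspension (F (succz n)))) -> P (F 0) -> forall n, P (F n).
Proof.
move=> tP FS P0; have [iso _ _] := tP.
have e n : P (F n) <-> P (F (succz n)).
  have s := strict_isomorphic (FS n).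
  split=> h; first by apply/(thick_suspension _ tP); apply: iso h.
  by apply: iso (isomorphic_sym s) _; apply/(thick_suspension _ tP).
elim/int_ind => // n IH; first by rewrite -addn1 PoszD; apply: (e n%:Z).1.
by apply/e; have -> : succz (- n.+1%:Z) = - n%:Z by rewrite /succz; lia.
Qed.

Lemma thick_sphere P : thick P -> P (ring_complex R) -> forall n, P (sphere n).
Proof.
move=> tP Pr; have [iso _ _] := tP; apply: thick_shifts => //; first exact: sphere_suspension.
by apply: iso Pr; apply: isomorphic_sym; apply: strict_isomorphic; apply: sphere_ring.
Qed.

Lemma thick_moore_sphere P (a : R) : thick P -> P (moore a) -> forall n, P (cone (scalar_map a (sphere n))).
Proof.
move=> tP Pr; have [iso _ _] := tP; apply: (thick_shifts (F := fun n => cone (scalar_map a (sphere n)))) => //.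
  move=> n; have [f [g [gf fg]]] := scalar_cone_iso a (sphere_suspension n).
  have [f' [g' [gf' fg']]] := scalar_cone_suspension a (sphere (succz n)).
  by exists (chain_comp f' f), (chain_comp g g'); split=> m x /=; rewrite ?gf' ?gf ?fg ?fg'.
apply: iso Pr; apply: isomorphic_sym; apply: strict_isomorphic.
by apply: scalar_cone_iso; apply: sphere_ring.
Qed.

Lemma thick_moore_mul P (a b : R) : thick P -> P (moore a) -> P (moore b) -> P (moore (a * b)).
Proof.
move=> tP Pa Pb; apply: (thick_octahedron (f := scalar_map b (ring_complex R))
  (g := scalar_map a (ring_complex R))) => // n x.
by rewrite /= scalerA.
Qed.

Lemma thick_moore_unit P (a : R) : thick P -> a \is a GRing.unit -> P (moore a).
Proof. by move=> tP ua; apply: thick_contractible => //; apply: scalar_cone_unit. Qed.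
End Spheres.

(** * Factorisation in principal ideal domains *)

Section PrincipalIdealDomains.
Variables (R : idomainType) (hR : principal_ideal_domain R).

Definition divides (a x : R) : Prop := exists b, x = b * a.

Lemma principal_pred (I : R -> Prop) : I 0 -> (forall a x y, I x -> I y -> I (a * x + y)) ->
  exists2 a, I a & forall x, I x -> divides a x.
Proof.
move=> I0 ID; have [|a ga] := hR (I := fun x => `[< I x >]).
  by split=> [|a x y /asboolP Ix /asboolP Iy]; apply/asboolP => //; apply: ID.
exists a; first by apply/asboolP; apply/(ga a); exists 1; rewrite mul1r.
by move=> x Ix; apply/(ga x)/asboolP.
Qed.

Lemma pid_acc (a : nat -> R) : (forall n, divides (a n.+1) (a n)) ->
  exists n, divides (a n) (a n.+1).
Proof.
move=> da; have dam m n : (m <= n)%N -> divides (a n) (a m).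
  elim: n => [|n IH]; first by rewrite leqn0 => /eqP->; exists 1; rewrite mul1r.
  rewrite leq_eqVlt => /orP[/eqP->|/IH[b ->]]; first by exists 1; rewrite mul1r.
  by have [c ->] := da n; exists (b * c); rewrite mulrA.
have [||c [n [b cE]] hc] := @principal_pred (fun x => exists n, divides (a n) x).
- by exists 0%N, 0; rewrite mul0r.
- move=> r x y [m [u ->]] [n [v ->]]; exists (maxn m n).
  have [u' ->] := dam _ _ (leq_maxl m n); have [v' ->] := dam _ _ (leq_maxr m n).
  by exists (r * u * u' + v * v'); ring.
exists n; have [|d ->] := hc (a n.+1); first by exists n.+1, 1; rewrite mul1r.
by exists (d * b); rewrite cE mulrA.
Qed.

(** Induction on proper divisors: a counterexample would have a proper divisor that is again one,
    and iterating this choice contradicts [pid_acc]. *)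
Lemma pid_divisor_ind (P : R -> Prop) :
  (forall b, b != 0 -> (forall c, divides c b -> ~ divides b c -> P c) -> P b) ->
  forall b, b != 0 -> P b.
Proof.
move=> step b0 b0_neq0; apply: contrapT => nP0.
pose bad := {b | b != 0 /\ ~ P b}.
have next (b : bad) : exists c : bad, divides (sval c) (sval b) /\ ~ divides (sval b) (sval c).
  case: b => b [bn0 nPb] /=; apply: contrapT => h; apply: nPb; apply: step => // c cb nbc.
  apply: contrapT => nPc; apply: h.
  have cn0 : c != 0 by apply: contraNneq bn0 => c0; have [d ->] := cb; rewrite c0 mulr0.
  by exists (exist _ c (conj cn0 nPc)).
have [f hf] := choice next.
have [n] := @pid_acc (fun n => sval (iter n f (exist _ b0 (conj b0_neq0 nP0)))) (fun n => (hf _).1).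
exact: (hf _).2.
Qed.

(* A counterexample whose proper divisors all satisfy P generates a prime ideal. *)
Lemma pid_prime_ind (P : R -> Prop) : (forall u, u \is a GRing.unit -> P u) ->
  (forall (p : spec R) b, b != 0 -> generates b p -> P b) ->
  (forall a b, P a -> P b -> P (a * b)) -> forall b, b != 0 -> P b.
Proof.
move=> Pu Pp PM; apply: pid_divisor_ind => b bn0 IH; apply: contrapT => nPb.
pose I (x : R) := `[< divides b x >].
have I_ideal : idealr_closed I.
  split; first by apply/asboolP; exists 0; rewrite mul0r.
    apply/asboolP => -[c e]; apply: nPb; apply: Pu.
    by apply/unitrPr; exists c; rewrite mulrC -e.
  move=> a x y /asboolP[c ->] /asboolP[d ->]; apply/asboolP.
  by exists (a * c + d); ring.
have I_prime : prime_idealr_closed I.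
  move=> x y /asboolP[d xyE]; apply: contrapT => /negP; rewrite negb_or => /andP[/asboolP nx /asboolP ny].
  (* c is a gcd of b and x. In b = e c both factors are proper divisors: b dividing e would force b
     to divide y, and b dividing c would force it to divide x. *)
  have [||c [u [v cE]] hc] := @principal_pred (fun z => exists u v, z = u * b + v * x).
  - by exists 0, 0; rewrite !mul0r addr0.
  - move=> a _ _ [u [v ->]] [u' [v' ->]].
    by exists (a * u + u'), (a * v + v'); ring.
  have [|e bE] := hc b; first by exists 1, 0; ring.
  have [|x' xE] := hc x; first by exists 0, 1; ring.
  have cn0 : c != 0 by apply: contraNneq bn0 => c0; rewrite bE c0 mulr0.
  apply: nPb; rewrite bE; apply: PM.
    apply: IH; first by exists c; rewrite bE mulrC.
    move=> [k eE]; apply: ny; exists (k * (u * y + v * d)).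
    have kc : k * c = 1 by apply: (mulIf bn0); rewrite mul1r {2}bE eE; ring.
    transitivity (k * (u * b * y + v * (x * y))); last by rewrite xyE; ring.
    by rewrite -[LHS]mul1r -kc [in LHS]cE; ring.
  apply: IH; first by exists e.
  by move=> [k cE']; apply: nx; exists (x' * k); rewrite xE cE' mulrA.
apply: nPb; apply: (Pp (Spec I_ideal I_prime)) => // x.
by split=> [/asboolP|h]; last apply/asboolP.
Qed.
End PrincipalIdealDomains.

(** * Devissage *)

Section Functionals.
Variable R : idomainType.
Implicit Types M : lmodType R.

(* M embeds into R^m; c supplies m coordinates, and c i is ignored for i >= m. *)
Definition separated m M : Prop := exists c : nat -> {linear M -> R^o},
  forall x, (forall i, (i < m)%N -> c i x = 0) -> x = 0.

Lemma fg_projective_separated (M : proj_module R) : exists m, separated m M.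
Proof.
have [m [g hg]] := @proj_fg R M.
have lin : linear (fun v : 'rV[R]_m => \sum_i v 0 i *: g i).
  move=> a u v; rewrite scaler_sumr -big_split; apply: eq_bigr => i _ /=.
  by rewrite !mxE scalerDl scalerA.
have [|s hs] := @proj_proj R M _ _ (mk_linear lin) idfun.
  move=> x; have [c ->] := hg x; exists (\row_i c i).
  by apply: eq_bigr => i _; rewrite mxE.
have linc i : linear (fun x : M => (if insub i is Some j then s x 0 j else 0) : R^o).
  by move=> a x y; case: insubP => [j _ _|_]; rewrite ?linearP ?mxE ?scaler0 ?addr0.
exists m, (fun i => mk_linear (linc i)) => x hx.
rewrite -[x](hs x) (_ : s x = 0) ?linear0 //; apply/rowP => j; rewrite mxE.
by have := hx j (ltn_ord j); rewrite /= valK.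
Qed.

Lemma functional_div M (f : {linear M -> R^o}) a : a != 0 ->
  (forall x, divides a (f x)) -> exists g : {linear M -> R^o}, forall x, f x = g x * a.
Proof.
move=> an0 /choice[g hg].
have lin : linear (g : M -> R^o).
  move=> c x y; apply: (mulIf an0); rewrite -hg linearP !hg.
  by rewrite /GRing.scale /= mulrDl mulrA.
by exists (mk_linear lin).
Qed.

Lemma separated_split (hR : principal_ideal_domain R) m M : separated m.+1 M ->
  separated m M \/ exists e : {linear M -> R^o}, (exists x, e x = 1) /\
    exists c : nat -> {linear M -> R^o},
      forall x, e x = 0 -> (forall i, (i < m)%N -> c i x = 0) -> x = 0.
Proof.
move=> [c hc].
have [||a [y cy] ha] := principal_pred hR (I := fun r => exists x, c m x = r).
- by exists 0; rewrite linear0.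
- by move=> r _ _ [x <-] [y <-]; exists (r *: x + y); rewrite linearP.
have [e0|an0] := eqVneq a 0.
  left; exists c => x h; apply: hc => i; rewrite ltnS leq_eqVlt => /orP[/eqP->|/h//].
  by have [|d ->] := ha (c m x); [exists x | rewrite e0 mulr0].
right; have [x|e he] := @functional_div M (c m) a an0; first by apply: ha; exists x.
exists e; split; first by exists y; apply: (mulIf an0); rewrite -he cy mul1r.
exists c => x ex h; apply: hc => i; rewrite ltnS leq_eqVlt => /orP[/eqP->|/h//].
by rewrite he ex mul0r.
Qed.
End Functionals.

Section Supports.
Variable R : idomainType.

Lemma zero_idealr_closed : idealr_closed (fun x : R => x == 0).
Proof.
by split=> [||a x y /eqP -> /eqP ->]; rewrite unfold_in ?oner_eq0 // mulr0 addr0.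
Qed.

Lemma zero_prime_closed : prime_idealr_closed (fun x : R => x == 0).
Proof. by move=> x y; rewrite !unfold_in mulf_eq0. Qed.

Definition zero_prime : spec R := Spec zero_idealr_closed zero_prime_closed.

Lemma in_zero_prime x : (x \in zero_prime) = (x == 0).
Proof. by []. Qed.

Lemma specialisation_closed_zero (S : set (spec R)) : specialisation_closed S ->
  S zero_prime -> S = [set: spec R].
Proof.
move=> cS S0; apply/seteqP; split=> // q _; apply: cS S0 _ => x /eqP ->.
by case: (prime_ideal q).
Qed.

(** Multiplication by a is null-homotopic on the cone, through (x, y) -> (y, 0), so it kills the
    cohomology. *)
Lemma supp_scalar_cone (a : R) A (q : spec R) : supp (cone (scalar_map a A)) q -> a \in q.
Proof.
apply: contraPT => aq; apply/supp_dense => n [x y] c; exists a => //.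
have [dx dy] : - diff A _ x = 0 /\ a *: x + diff A _ y = 0 by move: c => [].
exists ((y, 0) : cone (scalar_map a A) n); apply/pair_equal_spec; split; rewrite /=.
  by apply/eqP; rewrite eq_sym -addr_eq0 dy.
by rewrite linear0 addr0.
Qed.
End Supports.

Lemma const_mx_eq0 (R : idomainType) (b : bool) (x : R) : b ->
  const_mx x = 0 :> 'rV[R]_b -> x = 0.
Proof. by case: b => // _ /rowP/(_ ord0); rewrite !mxE. Qed.

Lemma const_mx_surj (R : idomainType) (b : bool) (v : 'rV[R]_b) : exists x, const_mx x = v.
Proof.
case: b v => v; last by exists 0; apply/rowP => -[].
by exists (v 0 0); apply/rowP => j; rewrite mxE ord1.
Qed.

Section Devissage.
Variables (R : idomainType) (hR : principal_ideal_domain R) (S : set (spec R)).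
Hypothesis hS : specialisation_closed S.
Variable P : perfect R -> Prop.
Hypotheses (tP : thick P)
  (Pcone : forall a, a != 0 -> (forall q : spec R, a \in q -> S q) ->
     forall n, P (cone (scalar_map a (sphere R n))))
  (Psphere : S (zero_prime R) -> forall n, P (sphere R n)).

Definition vanishes_above (X : perfect R) (n0 : int) :=
  forall n, (n0 < n)%R -> forall x : X n, x = 0.
Definition vanishes_below (X : perfect R) (n0 : int) :=
  forall n, (n < n0)%R -> forall x : X n, x = 0.

Lemma kernel_reduction (X Q : perfect R) (p : chain_map X Q) (sp : forall n y, exists x, p n x = y) :
  supp X `<=` S -> supp Q `<=` S -> P Q ->
  (supp (kernel_complex sp) `<=` S -> P (kernel_complex sp)) -> P X.
Proof.
move=> sX sQ PQ IH; have [iso _ co] := tP; have [siso _ sco] := @thick_supp R S.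
have e := isomorphic_sym (kernel_cone_isomorphic sp).
have [_ c _] := co _ _ (kernel_map sp); have [_ _ s] := sco _ _ (kernel_map sp).
apply: c; last exact: iso e PQ.
by apply: IH; apply: s => //; apply: siso e sQ.
Qed.

Lemma top_reduction (L n0 : int) m (X : perfect R) :
  (forall Y : perfect R, vanishes_below Y L -> vanishes_above Y (n0 - 1) -> supp Y `<=` S -> P Y) ->
  vanishes_below X L -> vanishes_above X n0 -> separated m (X n0) -> supp X `<=` S -> P X.
Proof.
move=> IH; elim: m X => [|m IHm] X loX hiX sepX sX.
  apply: IH => // n hn x; have [e|ne] := eqVneq n n0; last by apply: hiX; lia.
  by subst n; have [c hc] := sepX; apply: hc.
have [/IHm|[e0 [[x1 e1] [c hc]]]] := separated_split hR sepX; first exact.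
(* The functional is extended by zero to all degrees, so that chain maps can be built from it
   without transport along n = n0. *)
have he n : exists e : {linear X n -> R^o}, (n != n0 -> forall x, e x = 0) /\
    (n = n0 -> (exists x, e x = 1) /\ exists c : nat -> {linear X n -> R^o},
      forall x, e x = 0 -> (forall i, (i < m)%N -> c i x = 0) -> x = 0).
  have [E|ne] := eqVneq n n0; last by exists \0; split=> // E; rewrite E eqxx in ne.
  by subst n; exists e0; split=> // _; split; [exists x1 | exists c].
pose e n := sval (cid (he n)).
have e_out n : n != n0 -> forall x, e n x = 0 by rewrite /e; case: cid => ? [].
have e_top n : n = n0 -> (exists x, e n x = 1) /\ exists c : nat -> {linear X n -> R^o},
      forall x, e n x = 0 -> (forall i, (i < m)%N -> c i x = 0) -> x = 0.
  by rewrite /e; case: cid => ? [].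
move: e e_out e_top => {e0 x1 e1 c hc he} e e_out e_top.
(* In degree n0 the kernel of p lies in the kernel of e, so m coordinates separate it and the
   induction on m applies. *)
have kernel_step (Q : perfect R) (p : chain_map X Q) (sp : forall n y, exists x, p n x = y) :
    (forall n x, n = n0 -> p n x = 0 -> e n x = 0) -> supp Q `<=` S -> P Q -> P X.
  move=> pe sQ PQ; apply: (kernel_reduction (sp := sp)) => // sK; apply: IHm => //.
  - by move=> n nL k; apply: val_inj; apply: loX.
  - by move=> n nL k; apply: val_inj; apply: hiX.
  have [_ [c hc]] := e_top n0 erefl.
  exists (fun i => c i \o kernel_incl (p n0)) => k h; apply: val_inj; apply: hc => //.
  by apply: (pe _ _ erefl); exact: kernelP.
have [n1 n1E] := succz_surj n0.
have [||a [y1 ey1] ha] := principal_pred hR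
    (I := fun r => exists x : X n1, e (succz n1) (diff X n1 x) = r).
- by exists 0; rewrite linear0 linear0.
- by move=> r _ _ [x <-] [y <-]; exists (r *: x + y); rewrite !linearP.
have ea n (x : X n) : divides a (e (succz n) (diff X n x)).
  have [E|ne] := eqVneq (succz n) n0.
    have E' : n = n1 by move: E; rewrite n1E => /addIr.
    by subst n; apply: ha; exists x.
  by rewrite e_out //; exists 0; rewrite mul0r.
(* x of top degree is a cycle: if q is not in supp X, some s x with s outside q is a
   boundary, and then s = e (s x) is in (a). *)
have in_supp (q : spec R) : a \in q -> S q.
  move=> aq; apply: contrapT => nS; have /supp_dense/(_ n1) : ~ supp X q by move=> /sX.
  have [[x ex] _] := e_top _ (esym n1E).
  move=> /(_ x)[|s hs [y dy]].
    by apply: hiX; rewrite n1E /succz; lia.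
  have [b eb] := ha _ (ex_intro _ y erefl).
  move: eb; rewrite dy linearZ /= ex /GRing.scale /= mulr1 => eb.
  by move/negP: hs; apply; rewrite eb; apply: prime_mulr.
have [a0|an0] := eqVneq a 0.
  have S0 : S (zero_prime R) by apply: in_supp; rewrite in_zero_prime a0.
  have eX n (x : X n) : e (succz n) (diff X n x) = 0.
    by have [d ->] := ea n x; rewrite a0 mulr0.
  have lin n : linear (fun x : X n => const_mx (e n x) : sphere R n0 n).
    by move=> r x y; rewrite linearP; apply/rowP => j; rewrite !mxE.
  have cm n (x : X n) : mk_linear (lin (succz n)) (diff X n x) = diff (sphere R n0) n (mk_linear (lin n) x).
    by rewrite /= eX; apply/rowP => j; rewrite !mxE.
  apply: (kernel_step (sphere R n0) (ChainMap cm)).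
  - move=> n v; have [E|ne] := eqVneq n n0; last first.
      by exists 0; rewrite linear0 [RHS](sphere_null ne).
    have [r <-] := const_mx_surj v; have [[x ex] _] := e_top n E.
    by exists (r *: x); rewrite /= linearZ /= ex /GRing.scale /= mulr1.
  - by move=> n x E; apply: const_mx_eq0; rewrite E.
  - by rewrite (specialisation_closed_zero hS S0).
  - exact: Psphere.
(* [phi] is e d / a, zero outside degree n0 - 1. It is the first cone coordinate, which lives in
   degree n + 1 of the sphere. *)
have hphi n := functional_div (f := e (succz n) \o diff X n) an0 (@ea n).
pose phi n := sval (cid (hphi n)).
have phiE n x : e (succz n) (diff X n x) = phi n x * a := svalP (cid (hphi n)) x.
have phi_out n x : succz n != n0 -> phi n x = 0.
  by move=> ne; apply: (mulIf an0); rewrite -phiE e_out // mul0r.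
have lin n : linear (fun x : X n =>
    (const_mx (phi n x), const_mx (e n x)) : cone (scalar_map a (sphere R n0)) n).
  move=> r x y; apply/pair_equal_spec; split; rewrite linearP; apply/rowP => j; rewrite !mxE //.
have cm n (x : X n) : mk_linear (lin (succz n)) (diff X n x)
    = diff (cone (scalar_map a (sphere R n0))) n (mk_linear (lin n) x).
  apply/pair_equal_spec; split; rewrite /=.
    rewrite (_ : phi _ _ = 0); first by apply/rowP => j; rewrite !mxE oppr0.
    by apply: (mulIf an0); rewrite -phiE diff_diff linear0 mul0r.
  by rewrite phiE addr0; apply/rowP => j; rewrite !mxE mulrC.
apply: (kernel_step _ (ChainMap cm)).
- move=> n [v w]; have [E|ne] := eqVneq n n0.
    have nE : succz n != n0 by rewrite E /succz; lia.
    have [r <-] := const_mx_surj w; have [[x ex] _] := e_top n E.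
    exists (r *: x); apply/pair_equal_spec; split; first by rewrite [LHS](sphere_null nE) [RHS](sphere_null nE).
    by rewrite /= linearZ /= ex /GRing.scale /= mulr1.
  have w0 : w = 0 := sphere_null ne w.
  have [E|nE] := eqVneq (succz n) n0; last first.
    by exists 0; rewrite linear0 w0; apply/pair_equal_spec; split; rewrite ?[RHS](sphere_null nE).
  have E' : n = n1 by move: E; rewrite n1E => /addIr.
  (* [y1] was chosen with e d y1 = a, hence phi y1 = 1. *)
  subst n; have [r rE] := const_mx_surj v; exists (r *: y1); apply/pair_equal_spec; split.
    rewrite /= linearZ /= (_ : phi n1 y1 = 1) /GRing.scale /= ?mulr1 //.
    by apply: (mulIf an0); rewrite -phiE ey1 mul1r.
  by rewrite w0 [LHS](sphere_null ne).
- move=> n x E; move/(congr1 snd); apply: const_mx_eq0; rewrite E; exact: eqxx.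
- by move=> q /supp_scalar_cone/in_supp.
- exact: Pcone.
Qed.

Theorem devissage (X : perfect R) : supp X `<=` S -> P X.
Proof.
move=> sX; have [N hN] := bounded X.
have loX : vanishes_below X (- N%:Z) by move=> n hn; apply: hN; lia.
(* The bound equals N, written as L - 1 + k with L = -N and k = 2 N + 1, the number of degrees from
   -N to N. The induction is on k with L fixed. *)
have hiX : vanishes_above X (- N%:Z - 1 + (N.*2.+1)%:Z) by move=> n hn; apply: hN; lia.
move: (N.*2.+1) (- N%:Z) => k L in loX hiX *.
elim: k X sX loX hiX {hN} => [|k IH] X sX loX hiX.
  have [_ nul _] := tP; apply: nul => n x.
  by have [nL|nL] := boolP (n < L)%R; [exact: loX | apply: hiX; lia].
have [m sepX] := fg_projective_separated (X (L - 1 + k.+1%:Z)).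
apply: top_reduction loX hiX sepX sX => Y loY hiY sY; apply: IH => // n hn; apply: hiY; lia.
Qed.
End Devissage.

(** * Characteristics of the generators *)

Section Generators.
Variables (R : idomainType) (q : spec R).

(** Index -1 is cohomological degree 0, where the sign is 1. *)
Lemma chi_concentrated (X : perfect R) :
  (forall n, n != -1 -> hom_len q X n = 0%N) -> chi q X = hom_len q X (-1).
Proof.
move=> h; have [N hN] := chiP q X; rewrite -(hN (N + 2)%N) ?leq_addr // /euler_sum.
pose F n := alt_sign (succz n) * (hom_len q X n)%:Z.
have F0 n : n != -1 -> F n = 0 by move=> n1; rewrite /F h ?mulr0.
rewrite (@window_sum_stable 2) ?leq_addl // => [|n hn]; last first.
  by apply: F0; apply: contraTneq hn => ->.
rewrite -/F /window_sum !big_nat_recl // big_geq // addr0.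
rewrite (F0 (0%Z - _)) // (F0 (2%Z - _)) // (F0 (3%Z - _)) // !addr0 add0r.
exact: mul1r.
Qed.

Lemma null_hom (X : perfect R) n : (forall x : X (succz n), x = 0) ->
  hom_fin q X n /\ hom_len q X n = 0%N.
Proof.
by move=> X0; apply: zero_module_len => //; [exact: boundaries_submod | exact: boundaries_cycles].
Qed.

Lemma ring_null n : n != -1 -> forall x : ring_complex R (succz n), x = 0.
Proof. by case: n => [[|n]|[|n]] //= _ x; apply/rowP => -[]. Qed.

Lemma moore_null (a : R) n : n != -1 -> n != -2 -> forall x : moore a (succz n), x = 0.
Proof.
move=> n1 n2 [x y]; apply/pair_equal_spec; split; last exact: ring_null.
by apply: ring_null; apply: contra n2 => /eqP; rewrite /succz => e; apply/eqP; lia.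
Qed.

Section Residue.
Variables (a : R) (an0 : a != 0) (ga : generates a q).

(** In degree -1 a cycle is killed by a nonzero element of a domain, hence zero. In degree 0 the
    cohomology is R / (a) = R / q, of length one at q. *)
Lemma moore_hom (n : int) : hom_fin q (moore a) n /\ hom_len q (moore a) n = (n == -1).
Proof.
have [->|n1] := eqVneq n (-1); last first.
  have [->|n2] := eqVneq n (-2); last exact: null_hom (moore_null n1 n2).
  apply: dense_len; first exact: boundaries_cycles.
  move=> [x y] [_ dx]; exists 1; first exact: prime_notin1.
  have x0 : (x : R^o) = 0.
    apply: (mulfI an0); rewrite mulr0.
    by move: dx; rewrite /= addr0.
  rewrite (_ : (x, y) = 0); first by rewrite scaler0; exact: (boundaries_submod _ _).1.
  apply/pair_equal_spec; split; first exact: x0.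
  by apply/rowP => -[].
have lin : linear (fun y : R^o => ((0, y) : moore a (succz (-1)))).
  by move=> c x y; rewrite pair_linE scaler0 addr0.
have fT (x : R^o) : [set: R^o] x -> @cycles R (moore a) (-1) (mk_linear lin x).
  by move=> _; apply/pair_equal_spec; split; apply/rowP => -[].
have sT : submod [set: R^o] by split.
have [f1 l1] := len_prime q.
have [|e el] := len_transfer q sT (@cycles_submod R (moore a) (-1)) fT
  (A := fun x => x \in q) (A' := @boundaries R (moore a) (-1)).
- split; first split=> //.
  + split; first by case: (prime_ideal q).
    by move=> c x y xq yq; case: (prime_ideal q) => _ _; apply.
  + exact: boundaries_submod.
  + exact: boundaries_cycles.
  split=> [[x y] _|x _].
    exists (y : R^o) => //; rewrite (_ : _ - _ = 0); first exact: (boundaries_submod _ _).1.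
    by apply/pair_equal_spec; split; [apply/rowP => -[] | rewrite /= subrr].
  split=> [/ga[b ->]|[[y z] /(congr1 snd) /= e]].
    exists ((b : ring_term R 0, 0) : moore a (-1)); apply/pair_equal_spec; split.
      by apply/rowP => -[].
    by rewrite /= addr0 mulrC.
  by apply/ga; exists (y : R^o); rewrite -e addr0 mulrC.
by split; [apply/e | rewrite /hom_len -el l1].
Qed.
End Residue.

Lemma moore_hom_notin (a : R) n : a \notin q -> hom_fin q (moore a) n /\ hom_len q (moore a) n = 0%N.
Proof.
move=> aq; have /supp_hom/(_ n)// : ~ supp (moore a) q.
by move=> /supp_scalar_cone; apply/negP.
Qed.
End Generators.

(** In degree 0 this is the length of R / 0 at the zero prime, that is, the rank of R. *)
Lemma ring_hom (R : idomainType) n :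
  hom_fin (zero_prime R) (ring_complex R) n /\ hom_len (zero_prime R) (ring_complex R) n = (n == -1).
Proof.
have [->|n1] := eqVneq n (-1); last exact: null_hom (ring_null n1).
rewrite /hom_fin /hom_len.
have -> : @boundaries R (ring_complex R) (-1) = (fun x : R^o => x \in zero_prime R).
  apply/funext => x; apply/propext; split=> [[y <-]|/eqP ->]; first by rewrite in_zero_prime.
  exact: (boundaries_submod _ _).1.
have -> : @cycles R (ring_complex R) (-1) = [set: R^o].
  by apply/funext => x; apply/propext; split.
exact: len_prime.
Qed.

(** * Generation by R or by Moore complexes, and the theorem *)

Section ThickGeneration.
Variables (R : idomainType) (hR : principal_ideal_domain R).

Lemma thick_all (P : perfect R -> Prop) : thick P -> P (ring_complex R) -> forall X, P X.
Proof.
move=> tP Pr X; have Ps := thick_sphere tP Pr; have [_ _ co] := tP.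
apply: (@devissage R hR [set: spec R]) => // a _ _ n.
by have [c _ _] := co _ _ (scalar_map a (sphere R n)); apply: c.
Qed.

Lemma thick_moore (S : set (spec R)) (hS : specialisation_closed S) (nS : S <> [set: spec R])
    (g : spec R -> R) (hg : forall p, S p -> generates (g p) p) (P : perfect R -> Prop) :
  thick P -> (forall p, S p -> P (moore (g p))) -> forall X, supp X `<=` S -> P X.
Proof.
move=> tP Pg; apply: (devissage hR hS) => //; last by move=> /(specialisation_closed_zero hS).
move=> a an0 aS; apply: thick_moore_sphere => //; move: a an0 aS.
apply: (pid_prime_ind hR (P := fun a => (forall q : spec R, a \in q -> S q) -> P (moore a))).
- by move=> u uu _; apply: thick_moore_unit.
(* b and [g p] generate the same ideal, so they differ by a unit u, and the Moore complex of u is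
   contractible. *)
- move=> p b bn0 gb bS.
  have bp : b \in p by apply/gb; exists 1; rewrite mul1r.
  have gp := hg p (bS p bp); have [u uE] := (gp b).1 bp.
  have [v vE] : divides b (g p) by apply/gb/gp; exists 1; rewrite mul1r.
  rewrite uE; apply: thick_moore_mul => //; last by apply: Pg; apply: bS.
  apply: thick_moore_unit => //; apply/unitrPr; exists v.
  by apply: (mulIf bn0); rewrite mul1r {2}uE vE mulrA.
- move=> a b Pa Pb abS; apply: thick_moore_mul => //.
    by apply: Pa => q aq; apply: abS; rewrite mulrC; apply: prime_mulr.
  by apply: Pb => q bq; apply: abS; apply: prime_mulr.
Qed.

(** Write a = c b. As p is prime, either b is in p and the ideals agree, or c = e a, and then 1 = e
    b would lie in p'. *)
Lemma nonzero_primes_maximal (p p' : spec R) a b : a != 0 -> generates a p -> generates b p' ->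
  a \in p' -> p = p'.
Proof.
move=> an0 ga gb /gb[c cE].
suff e x : (x \in p) = (x \in p').
  have e' : prime_pred p = prime_pred p' by apply/funext => x; apply: e.
  case: p p' e' {ga gb e cE} => P i1 j1 [P' i2 j2] /= e'; subst P'.
  by rewrite (Prop_irrelevance i1 i2) (Prop_irrelevance j1 j2).
have bp' : b \in p' by apply/gb; exists 1; rewrite mul1r.
have ap : a \in p by apply/ga; exists 1; rewrite mul1r.
apply/idP/idP => [/ga[d ->]|/gb[d ->]]; first by rewrite cE mulrA; apply: prime_mulr.
apply: prime_mulr; move: (ap); rewrite {1}cE => /(@prime_prime _ p _ _)/orP[/ga[e eE]|//].
have : 1 \in p'.
  rewrite (_ : 1 = e * b); first exact: prime_mulr.
  by apply: (mulfI an0); rewrite mulr1 {1}cE eE; ring.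
by rewrite (negbTE (prime_notin1 p')).
Qed.
End ThickGeneration.

Theorem theorem4p12 (R : idomainType) (hR : principal_ideal_domain R)
    (S : set (spec R)) (hS : specialisation_closed S) :
  (S = [set: spec R] ->
     exists hX : supp (ring_complex R) `<=` S,
       infinite_cyclic_on (K0_class (supported hX)))
  /\
  (S <> [set: spec R] ->
     forall g : spec R -> R, (forall p, S p -> generates (g p) p) ->
     exists hM : forall p, S p -> supp (moore (g p)) `<=` S,
       free_abelian_on
         (fun p : {p : spec R | S p} => K0_class (supported (hM (sval p) (svalP p))))).
Proof.
split=> [ST|nS g hg].
  have hX : supp (ring_complex R) `<=` S by rewrite ST.
  exists hX; pose f (m : int_group) := zmul m (K0_class (supported hX)).
  have hf : ab_hom f by move=> m n; apply: zmulD.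
  exists f; split; last exact: zmul1.
  (* At the zero prime finiteness of lengths spreads from R to every perfect complex. *)
  have fin X n : hom_fin (zero_prime R) X n.
    move: n; apply: (thick_all hR (thick_hom_fin (zero_prime R))) => n.
    by case: (ring_hom R n).
  have [F [hF FE]] := @K0_lift R S int_group (fun A => chi (zero_prime R) (sval A))
    (fun A B => @chi_iso _ _ _ _)
    (fun A B C f g h => @chi_triangle _ _ _ _ _ f g h (fin _) (fin _) (fin _)).
  have Fr : F (K0_class (supported hX)) = 1.
    rewrite FE chi_concentrated; first by have [_ ->] := ring_hom R (-1).
    by move=> n n1; have [_ ->] := ring_hom R n; rewrite (negbTE n1).
  (* The rank is a left inverse of f, which gives injectivity. *)
  have Ff (m : int) : F (f m) = m.
    have Fn n : F (nmul n (K0_class (supported hX))) = n%:Z.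
      by elim: n => [|n IH] /=; [exact: (hom0 hF) | rewrite hF IH Fr /=; lia].
    by case: m => n; [exact: Fn | rewrite /f /zmul homN // Fn NegzE].
  split=> // [x y e|]; first by rewrite -(Ff x) e Ff.
  apply: K0_ind; first exact: hom_image_subgroup.
  move=> [A hA].
  have [h' h] : in_K0 (fun y => exists x, f x = y) A.
    apply: (thick_all hR); first by apply: thick_in_K0; apply: hom_image_subgroup.
    by exists hX, 1; apply: zmul1.
  by move: h; rewrite (Prop_irrelevance hA h').
(* If [g p] were 0, then p would be the zero ideal and S, being specialisation-closed, the whole
   spectrum. *)
have gn0 p : S p -> g p != 0.
  move=> Sp; apply/eqP => g0; apply: nS; apply: (specialisation_closed_zero hS).
  by apply: (hS _ _ Sp) => x /(hg p Sp)[b ->]; rewrite g0 mulr0 in_zero_prime.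
have hM p : S p -> supp (moore (g p)) `<=` S.
  move=> Sp q /supp_scalar_cone gq; apply: (hS _ _ Sp) => x /(hg p Sp)[b ->].
  exact: prime_mulr.
exists hM; pose J := {p : spec R | S p}.
pose e (p : J) : K0 S := K0_class (supported (hM (sval p) (svalP p))).
have hf := @free_lift_hom J (K0 S) e.
exists (free_lift e); split; last by move=> p; exact: free_lift_gen.
have hom_moore (p p' : J) n : hom_fin (sval p) (moore (g (sval p'))) n /\
    hom_len (sval p) (moore (g (sval p'))) n = (`[< p' = p >] && (n == -1)).
  case: p p' => p Sp [p' Sp'] /=; have [gp|gp] := boolP (g p' \in p); last first.
    rewrite asboolF; first exact: moore_hom_notin.
    move=> [E]; subst p'; case/negP: gp.
    by apply/(hg p Sp); exists 1; rewrite mul1r.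
  have E := nonzero_primes_maximal (gn0 _ Sp') (hg _ Sp') (hg _ Sp) gp.
  subst p'; rewrite asboolT; last by rewrite (Prop_irrelevance Sp Sp').
  by apply: moore_hom; [apply: gn0 | apply: hg].
(* Finite length at p passes from the Moore complexes to everything supported on S; only then does
   chi_p descend to K_0. *)
have fin (p : J) (A : supported_complex S) n : hom_fin (sval p) (sval A) n.
  move: n; apply: (thick_moore hR hS nS hg (thick_hom_fin (sval p))) (svalP A) => p' Sp' n.
  by have [] := hom_moore p (exist _ p' Sp') n.
split; first exact: hf.
- apply: (hom_injective hf) => v fv0; apply: fin_suppP => p.
  have [F [hF FE]] := @K0_lift R S int_group (fun A => chi (sval p) (sval A))
    (fun A B => @chi_iso _ _ _ _)
    (fun A B C f g h => @chi_triangle _ _ _ _ _ f g h (fin p A) (fin p B) (fin p C)).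
  (* chi_p reads off the coordinate at p. Both sides are homomorphisms in [w], so they need to be
     compared on generators only. *)
  suff Ff w : F (free_lift e w) = w p by rewrite -Ff fv0 (hom0 hF).
  move: w; apply: (free_group_ind (hom_equalizer (f := fun w => F (free_lift e w))
    (g := fun w : free_group J => w p : int_group) _ _)) => //.
    by move=> w w'; rewrite hf hF.
  move=> p'; rewrite free_lift_gen FE chi_concentrated /=.
    by have [_ ->] := hom_moore p p' (-1); rewrite andbT.
  by move=> n n1; have [_ ->] := hom_moore p p' n; rewrite (negbTE n1) andbF.
apply: K0_ind; first exact: (hom_image_subgroup hf).
move=> [A hA].
have [h' h] : in_K0 (fun y => exists x, free_lift e x = y) A.
  apply: (thick_moore hR hS nS hg (thick_in_K0 (hom_image_subgroup hf))) hA => p Sp.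
  exists (hM p Sp), (free_gen (exist _ p Sp : J)); rewrite free_lift_gen.
  by congr (K0_class (supported _)); exact: Prop_irrelevance.
by move: h; rewrite (Prop_irrelevance hA h').
Qed.
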